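(* The map $$\Psi(\pi_1,\pi_2):=\pi_1\nearrow\pi_2+(\mathrm{Leb}_{[0,1]}-\pi_1)\nearrow(\mathrm{Leb}_{[0,1]}-\pi_2)$$ is a continuous surjective map from $\mathcal D$ to the set of $321$-avoiding permutons. Moreover, for any $321$-avoiding permuton $\mu$, denoting by $\mu_{\mathrm{lr}}$ and $\mu_{\mathrm{diag}}$ the restrictions of $\mu$ to $\{(x,y)\in[0,1]^2:x>y\}$ and to $\{(x,y)\in[0,1]^2:x=y\}$ respectively, we have $$\Psi^{-1}(\mu)=\big\{\mathrm{proj}(\mu_{\mathrm{lr}}+\nu):0\le\nu\le\mu_{\mathrm{diag}}\big\},$$ where $\nu$ ranges over Borel measures on $[0,1]^2$.
   Context: A permuton is a Borel probability measure $\mu$ on $[0,1]^2$ whose two marginals are the Lebesgue measure on $[0,1]$; the set of permutons has the topology of weak convergence. A permuton $\mu$ is $321$-avoiding if $\mu^{\otimes3}\big(\{((x_i,y_i))_{1\le i\le 3}: x_1<x_2<x_3,\ y_1>y_2>y_3\}\big)=0$. For measures, $\mu_1\le\mu_2$ means $\mu_1(A)\le\mu_2(A)$ for every Borel set $A$. $\mathcal M([0,1])$ is the space of finite Borel measures on $[0,1]$ with the topology of weak convergence. Define $$\mathcal D:=\left\{(\pi_1,\pi_2)\in\mathcal M([0,1])^2:\ \pi_1\le\mathrm{Leb},\ \pi_2\le\mathrm{Leb},\ \pi_1([0,1])=\pi_2([0,1]),\ \forall x\in[0,1],\ \pi_1([0,x])\le\pi_2([0,x])\right\}.$$ A subset $S\subseteq\mathbb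 R^2$ is nondecreasing if $(x_1-x_2)(y_1-y_2)\ge0$ for all $(x_1,y_1),(x_2,y_2)\in S$. For finite measures $\mu,\nu$ on $[0,1]$ with the same total mass, $\mu\nearrow\nu$ is the unique measure on $[0,1]^2$ with first marginal $\mu$, second marginal $\nu$, and nondecreasing support (the zero measure if the total mass is $0$). For a finite measure $\pi$ on $[0,1]^2$, $\mathrm{proj}(\pi)$ is the pair $(\pi_1,\pi_2)$ of its projections (marginals) on the horizontal and vertical axes. *)

(* Defs.v *)
From HB Require Import structures.
From mathcomp Require Import all_boot all_order all_algebra.
From mathcomp Require Import all_classical all_reals all_analysis.
From mathcomp Require Import measurable_realfun.

Set Implicit Arguments.
Unset Strict Implicit.
Unset Printing Implicit Defensive.

Import Order.TTheory GRing.Theory Num.Theory.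
Import numFieldNormedType.Exports.

Local Open Scope classical_set_scope.
Local Open Scope ring_scope.
Local Open Scope ereal_scope.

(* A finite Borel measure on D is a finite measure on the ambient space T that
   does not charge ~` D. The library's measures are functions on all subsets of
   T, unconstrained outside the sigma-algebra; the value there is normalized to
   0, so that Leibniz equality is equality of measures (bmeasure_eq below). *)
Record bmeasure d (T : measurableType d) (R : realType) (D : set T) := BMeasure {
  bm :> {finite_measure set T -> \bar R} ;
  bm_off : bm (~` D) = 0 ;
  bm_nonmeasurable : forall A, ~ measurable A -> bm A = 0 }.

Section bmeasure_theory.
Context d (T : measurableType d) (R : realType) (D : set T).
Implicit Types mu nu : bmeasure R D.

Lemma bmeasure_eq mu nu :
  (forall A, measurable A -> mu A = nu A) -> mu = nu.
Proof.
move=> munu.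
have munuE : mu = nu :> (set T -> \bar R).
  apply/funext => A; have [/munu//|nmA] := pselect (measurable A).
  by rewrite !bm_nonmeasurable.
case: mu nu munuE {munu} => -[f cf] p1 p2 [[g cg] q1 q2] /= fg.
move: cf p1 p2; rewrite {f}fg => cf p1 p2.
have cfg : cf = cg.
  case: cf {p1 p2} => [[a0 a1] [a2] [a3] [a4] [a5]].
  case: cg {q1 q2} => [[b0 b1] [b2] [b3] [b4] [b5]].
  rewrite (Prop_irrelevance a0 b0) (Prop_irrelevance a1 b1).
  rewrite (Prop_irrelevance a2 b2) (Prop_irrelevance a3 b3).
  by rewrite (Prop_irrelevance a4 b4) (Prop_irrelevance a5 b5).
by move: p1 p2; rewrite cfg => p1 p2; congr BMeasure; exact: Prop_irrelevance.
Qed.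

HB.instance Definition _ := gen_eqMixin (bmeasure R D).
HB.instance Definition _ := gen_choiceMixin (bmeasure R D).

Definition bmeasure_le mu nu := forall A, measurable A -> mu A <= nu A.

End bmeasure_theory.

Section make_bmeasure.
Context d (T : measurableType d) (R : realType) (D : set T).
Variable f : set T -> \bar R.
Hypothesis f0 : f set0 = 0.
Hypothesis f_ge0 : forall A, measurable A -> 0 <= f A.
Hypothesis f_fin : forall A, measurable A -> f A \is a fin_num.
Hypothesis f_sigma_additive : semi_sigma_additive f.
Hypothesis f_off : f (~` D) = 0.

Definition trunc_measurable of f set0 = 0 & (forall A, measurable A -> 0 <= f A)
    & (forall A, measurable A -> f A \is a fin_num) & semi_sigma_additive f :=
  fun A : set T => if `[< measurable A >] then f A else 0.

Local Notation tf := (trunc_measurable f0 f_ge0 f_fin f_sigma_additive).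

Lemma trunc_measurableE A : measurable A -> tf A = f A.
Proof. by rewrite /trunc_measurable => /asboolP ->. Qed.

Let tf0 : tf set0 = 0.
Proof. by rewrite trunc_measurableE. Qed.

Let tf_ge0 A : 0 <= tf A.
Proof. by rewrite /trunc_measurable; case: asboolP => // /f_ge0. Qed.

Let tf_sigma_additive : semi_sigma_additive tf.
Proof.
move=> F mF tF mUF; rewrite trunc_measurableE//.
under eq_fun do under eq_bigr do rewrite trunc_measurableE//.
exact: f_sigma_additive.
Qed.

HB.instance Definition _ := isMeasure.Build _ _ _ tf
  tf0 tf_ge0 tf_sigma_additive.

Let tf_fin : fin_num_fun tf.
Proof. by move=> A mA; rewrite trunc_measurableE//; exact: f_fin. Qed.

HB.instance Definition _ := @Measure_isFinite.Build _ T _ tf tf_fin.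

Let tf_off : tf (~` D) = 0.
Proof. by rewrite /trunc_measurable; case: asboolP. Qed.

Let tf_nonmeasurable A : ~ measurable A -> tf A = 0.
Proof. by rewrite /trunc_measurable; case: asboolP. Qed.

Definition make_bmeasure : bmeasure R D := BMeasure tf_off tf_nonmeasurable.

Lemma make_bmeasureE A : measurable A -> make_bmeasure A = f A.
Proof. exact: trunc_measurableE. Qed.

End make_bmeasure.

Section bmeasure_operations.
Context d (T : measurableType d) (R : realType) (D : set T).
Implicit Types mu nu : bmeasure R D.

Let zero_off : @mzero d T R (~` D) = 0. Proof. by []. Qed.

Definition bmeasure0 : bmeasure R D :=
  make_bmeasure (measure0 (@mzero d T R)) (fun A _ => measure_ge0 _ A)
    (fun A _ => isT) (@measure_semi_sigma_additive _ _ _ (@mzero d T R)) zero_off.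

HB.instance Definition _ := isPointed.Build (bmeasure R D) bmeasure0.

Section add.
Variables mu nu : bmeasure R D.
Local Notation s := (measure_add mu nu).

Let s_fin A : measurable A -> s A \is a fin_num.
Proof. by move=> mA; rewrite measure_addE fin_numD !fin_num_measure. Qed.

Let s_off : s (~` D) = 0.
Proof. by rewrite measure_addE [X in X + _](bm_off mu) [X in _ + X](bm_off nu) adde0. Qed.

Definition bmeasure_add : bmeasure R D :=
  make_bmeasure (measure0 s) (fun A _ => measure_ge0 s A) s_fin
    (@measure_semi_sigma_additive _ _ _ s) s_off.

Lemma bmeasure_addE A : measurable A -> bmeasure_add A = mu A + nu A.
Proof. by move=> mA; rewrite make_bmeasureE//; exact: measure_addE. Qed.

End add.

(* Total in mu and nu: the junk value is the zero measure if nu is not below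
   mu. *)
Section sub.
Variables mu nu : bmeasure R D.

Definition sub_fun (A : set T) : \bar R :=
  if `[< bmeasure_le nu mu >] then mu A - nu A else 0.

Let sub0 : sub_fun set0 = 0.
Proof. by rewrite /sub_fun; case: asboolP => // _; rewrite !measure0 sube0. Qed.

Let sub_ge0 A : measurable A -> 0 <= sub_fun A.
Proof.
move=> mA; rewrite /sub_fun; case: asboolP => // numu.
by rewrite sube_ge0 ?numu// fin_num_measure.
Qed.

Let sub_fin A : measurable A -> sub_fun A \is a fin_num.
Proof.
by move=> mA; rewrite /sub_fun; case: asboolP => // _;
  rewrite fin_numB !fin_num_measure.
Qed.

Let sub_sigma_additive : semi_sigma_additive sub_fun.
Proof.
move=> F mF tF mUF; rewrite /sub_fun; case: asboolP => numu; last first.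
  under eq_fun do rewrite big1//.
  exact: cvg_cst.
rewrite [X in X @ _](_ : _ = (fun n => \sum_(0 <= i < n) mu (F i)) \-
    (fun n => \sum_(0 <= i < n) nu (F i))); last first.
  apply/funext => n /=; elim: n => [|n IHn].
    by rewrite !big_geq// sube0.
  rewrite !big_nat_recr//= IHn fin_num_oppeD ?fin_num_measure//.
  by rewrite addeACA.
apply: cvgeB; last 2 first.
- exact: measure_semi_sigma_additive.
- exact: measure_semi_sigma_additive.
- by rewrite fin_num_adde_defl// fin_numN fin_num_measure.
Qed.

Let sub_off : sub_fun (~` D) = 0.
Proof. by rewrite /sub_fun; case: asboolP => // _; rewrite !bm_off sube0. Qed.

Definition bmeasure_sub : bmeasure R D :=
  make_bmeasure sub0 sub_ge0 sub_fin sub_sigma_additive sub_off.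

Lemma bmeasure_subE A : bmeasure_le nu mu -> measurable A ->
  bmeasure_sub A = mu A - nu A.
Proof.
by move=> numu mA; rewrite make_bmeasureE// /sub_fun; case: asboolP.
Qed.

End sub.

Section restriction.
Variables (mu : bmeasure R D) (B : set T) (mB : measurable B) (mD : measurable D).
Local Notation r := (mrestr mu mB).

Let r_off : r (~` D) = 0.
Proof.
apply/eqP; rewrite eq_le measure_ge0 andbT -(bm_off mu) /mrestr.
apply: le_measure; rewrite ?inE//; [|exact: measurableC].
by apply: measurableI => //; exact: measurableC.
Qed.

Definition bmeasure_restr : bmeasure R D :=
  make_bmeasure (measure0 r) (fun A _ => measure_ge0 r A) (fin_num_measure r)
    (@measure_semi_sigma_additive _ _ _ r) r_off.

Lemma bmeasure_restrE A : measurable A -> bmeasure_restr A = mu (A `&` B).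
Proof. by move=> mA; rewrite make_bmeasureE. Qed.

End restriction.

Section image.
Context d' (T' : measurableType d') (D' : set T').
Variables (mu : bmeasure R D) (f : T -> T').
Hypothesis mf : measurable_fun [set: T] f.
Hypothesis mD' : measurable D'.
Hypothesis mD : measurable D.
Hypothesis fD : D `<=` f @^-1` D'.
Local Notation p := (pushforward mu f).

Let mfpre A : measurable A -> measurable (f @^-1` A).
Proof. by move=> mA; rewrite -[X in measurable X]setTI; exact: mf. Qed.

Let p0 : p set0 = 0.
Proof. by rewrite /pushforward preimage_set0 measure0. Qed.

Let p_fin A : measurable A -> p A \is a fin_num.
Proof. by move=> mA; apply: fin_num_measure; exact: mfpre. Qed.

Let p_sigma_additive : semi_sigma_additive p.
Proof.
move=> F mF tF mUF; rewrite /pushforward preimage_bigcup.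
apply: measure_semi_sigma_additive.
- by move=> n; exact: mfpre.
- apply/trivIsetP => /= i j _ _ ij; rewrite -preimage_setI.
  by move/trivIsetP : tF => /(_ _ _ _ _ ij) ->//; rewrite preimage_set0.
- by rewrite -preimage_bigcup; exact: mfpre.
Qed.

Let p_off : p (~` D') = 0.
Proof.
apply/eqP; rewrite eq_le /pushforward measure_ge0 andbT -(bm_off mu).
apply: le_measure; rewrite ?inE//.
- by apply: mfpre; exact: measurableC.
- exact: measurableC.
- by rewrite preimage_setC; exact: subsetC.
Qed.

Definition bmeasure_image : bmeasure R D' :=
  make_bmeasure p0 (fun A _ => measure_ge0 mu _) p_fin p_sigma_additive p_off.

Lemma bmeasure_imageE A : measurable A -> bmeasure_image A = mu (f @^-1` A).
Proof. by move=> mA; rewrite make_bmeasureE. Qed.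

End image.

End bmeasure_operations.

Section unit_interval_and_square.
Variable R : realType.

Definition unit_interval : set R := `[0%R, 1%R]%classic.
Definition unit_square : set (R * R) := unit_interval `*` unit_interval.

Lemma measurable_unit_interval : measurable unit_interval.
Proof. exact: measurable_itv. Qed.

Lemma measurable_unit_square : measurable unit_square.
Proof. by apply: measurableX; exact: measurable_unit_interval. Qed.

(* M([0,1]) and M([0,1]^2), with the topology of weak convergence: the initial
   topology of the maps mu |-> \int f dmu, for f real-valued and continuous on
   the (compact) set carrying the measures. *)
Definition meas1 := bmeasure R unit_interval.
Definition meas2 := bmeasure R unit_square.

Definition test1 : set (R -> R) :=
  [set f | {within unit_interval, continuous f}].

Definition test2 : set (R * R -> R) :=
  [set f | {within unit_square, continuous f}].

Definition weak_eval1 (mu : meas1) : prod_topology (fun _ : test1 => R) :=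
  fun f => (\int[mu]_(x in unit_interval) set_val f x)%R.

Definition weak_eval2 (mu : meas2) : prod_topology (fun _ : test2 => R) :=
  fun f => (\int[mu]_(z in unit_square) set_val f z)%R.

HB.instance Definition _ := Pointed.on meas1.
HB.instance Definition _ := Pointed.on meas2.
HB.instance Definition _ :=
  Topological.copy meas1 (initial_topology weak_eval1).
HB.instance Definition _ :=
  Topological.copy meas2 (initial_topology weak_eval2).

Section Lebesgue.
Local Notation r := (mrestr (@lebesgue_measure R) measurable_unit_interval).

Let r_fin A : measurable A -> r A \is a fin_num.
Proof.
move=> mA; rewrite ge0_fin_numE//.
apply: (@le_lt_trans _ _ (lebesgue_measure unit_interval)).
  apply: le_measure; rewrite ?inE//; last exact: measurable_unit_interval.
  by apply: measurableI => //; exact: measurable_unit_interval.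
by rewrite /unit_interval lebesgue_measure_itv/=; case: ifPn => _; rewrite ltry.
Qed.

Let r_off : r (~` unit_interval) = 0.
Proof. by rewrite /mrestr setICl measure0. Qed.

Definition leb : meas1 :=
  @make_bmeasure _ R R unit_interval r (measure0 r)
    (fun A _ => measure_ge0 r A) r_fin (@measure_semi_sigma_additive _ _ _ r)
    r_off.

Lemma lebE A : measurable A -> leb A = lebesgue_measure (A `&` unit_interval).
Proof. by move=> mA; rewrite make_bmeasureE. Qed.

End Lebesgue.

Let fst_unit_square : unit_square `<=` fst @^-1` unit_interval.
Proof. by move=> z []. Qed.

Let snd_unit_square : unit_square `<=` snd @^-1` unit_interval.
Proof. by move=> z []. Qed.

Definition marginal1 (mu : meas2) : meas1 :=
  bmeasure_image mu measurable_fst measurable_unit_interval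
    measurable_unit_square fst_unit_square.

Definition marginal2 (mu : meas2) : meas1 :=
  bmeasure_image mu measurable_snd measurable_unit_interval
    measurable_unit_square snd_unit_square.

Definition marginals (mu : meas2) : meas1 * meas1 := (marginal1 mu, marginal2 mu).

Definition nondecreasing_set (S : set (R * R)) :=
  forall z w, S z -> S w -> (0 <= (z.1 - w.1) * (z.2 - w.2))%R.

Definition msupport (mu : meas2) : set (R * R) :=
  [set z | forall U, open U -> U z -> 0 < mu U].

(* The measure written mu nearrow nu; it exists and is unique when mu and nu
   have the same total mass, and get returns a junk value otherwise. *)
Definition nearrow (mu nu : meas1) : meas2 :=
  get [set p : meas2 | [/\ marginal1 p = mu, marginal2 p = nu
                & nondecreasing_set (msupport p)]].

Definition permuton : set meas2 :=
  [set mu : meas2 | [/\ mu unit_square = 1, marginal1 mu = leb & marginal2 mu = leb]].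

Definition avoids321 (mu : meas2) :=
  ((mu \x mu) \x mu)
    [set z | [/\ (z.1.1.1 < z.1.2.1)%R, (z.1.2.1 < z.2.1)%R,
                 (z.1.1.2 > z.1.2.2)%R & (z.1.2.2 > z.2.2)%R]] = 0.

Definition permuton321 : set meas2 := [set mu : meas2 | permuton mu /\ avoids321 mu].

Definition Dset : set (meas1 * meas1) :=
  [set p : meas1 * meas1 | [/\ bmeasure_le p.1 leb, bmeasure_le p.2 leb,
               p.1 unit_interval = p.2 unit_interval
             & forall x, unit_interval x ->
                 p.1 `[0%R, x]%classic <= p.2 `[0%R, x]%classic]].

Definition Psi (p : meas1 * meas1) : meas2 :=
  bmeasure_add (nearrow p.1 p.2)
    (nearrow (bmeasure_sub leb p.1) (bmeasure_sub leb p.2)).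

Lemma measurable_lower_right : measurable [set z : R * R | (z.2 < z.1)%R].
Proof.
have /(_ measurableT) := @measurable_lte _ (R * R)%type R setT.
move=> /(_ (EFin \o snd) (EFin \o fst)); rewrite setTI; apply.
- by apply/measurable_EFinP; exact: measurable_snd.
- by apply/measurable_EFinP; exact: measurable_fst.
Qed.

Lemma measurable_diagonal : measurable [set z : R * R | z.1 = z.2].
Proof.
rewrite (_ : [set _ | _] =
    setT `&` [set z : R * R | (EFin \o fst) z = (EFin \o snd) z]).
  apply: measurable_eqe => //.
  - by apply/measurable_EFinP; exact: measurable_fst.
  - by apply/measurable_EFinP; exact: measurable_snd.
by rewrite setTI; apply/seteqP; split => z /= [->].
Qed.

(* The two sets need not be intersected with the square, since mu does not charge
   its complement. *)
Definition meas_lr (mu : meas2) : meas2 :=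
  bmeasure_restr mu measurable_lower_right measurable_unit_square.

Definition meas_diag (mu : meas2) : meas2 :=
  bmeasure_restr mu measurable_diagonal measurable_unit_square.

End unit_interval_and_square.

(* Main.v *)
Require Import Defs.
From HB Require Import structures.
From mathcomp Require Import all_boot all_order all_algebra.
From mathcomp Require Import all_classical all_reals all_analysis.
From mathcomp Require Import measurable_realfun ring lra.

(** A coupling p has nondecreasing support exactly when, for every point (x, y),
    p cannot charge both the quadrant up and to the left of (x, y) and the one
    down and to the right of it ([nondecreasing_msupportP]). Hence its joint
    distribution function is the minimum of the two marginal ones
    ([nondecreasing_quadrant]); this makes the monotone coupling unique, and
    pushing Lebesgue measure forward along the pair of quantile functions gives
    its existence ([nearrow_exists]).

    A measure carried by the union of two nondecreasing sets avoids 321, because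
    among three points of such a union two are not in decreasing position
    ([nondecreasing_cover_avoids321]); this applies to every value of Psi.
    In the other direction, let mu be a 321-avoiding permuton: no three points
    of its support are in decreasing position ([avoids321_msupport]). If z is up
    and to the left of w in this support, nothing of mu lies further up and to
    the left of z; since the marginals are uniform, z on or below the diagonal
    would leave no mass down and to the right of z, where w is. So the two
    points of an inversion lie strictly on opposite sides of the diagonal
    ([permuton321_inversion]): the part of the support on or below the diagonal
    and the part on or above it are both nondecreasing.

    Consequently a splitting mu = p + q with p carried by the closed lower side
    and q by the closed upper side is a splitting into monotone couplings, so
    that Psi sends the marginals of p to mu ([Psi_lr_diag]). Conversely, for
    (pi1, pi2) in the domain of Psi, the inequality between the distribution
    functions of pi1 and pi2 puts the first summand of Psi on the lower side and
    the second one on the upper side ([PsiP]); the first summand is then the part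
    of mu strictly below the diagonal plus some share of the diagonal part
    ([Psi_inverse]).

    For continuity, the distribution functions of measures dominated by Lebesgue
    measure are 1-Lipschitz, so that they depend continuously on the measure for
    the weak topology ([cvg_mcdf]). By the formula with minima, so does the mass
    that Psi gives to a rectangle ([Psi_quadrant]). Finally the integral of a
    continuous function against Psi is, uniformly over the domain, approximated
    by finite combinations of masses of rectangles ([Rintegral_approx]). *)

Set Implicit Arguments.
Unset Strict Implicit.
Unset Printing Implicit Defensive.

Import Order.TTheory GRing.Theory Num.Theory.
Import numFieldNormedType.Exports.

Local Open Scope classical_set_scope.
Local Open Scope ring_scope.
Local Open Scope ereal_scope.

(** * Finite measures, rays and quadrants *)

Section finite_measures.
Context d (T : measurableType d) (R : realType).
Implicit Types mu : {measure set T -> \bar R}.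

Lemma measure_splitI mu A B : measurable A -> measurable B ->
  mu A = mu (A `&` B) + mu (A `&` ~` B).
Proof.
move=> mA mB; rewrite -measureU; last 3 first.
- exact: measurableI.
- by apply: measurableI => //; exact: measurableC.
- by rewrite setIACA setICr setI0.
by rewrite -setIUr setUCr setIT.
Qed.

Lemma bmeasure_setI (D : set T) (mu : bmeasure R D) A : measurable D ->
  measurable A -> mu (A `&` D) = mu A.
Proof.
move=> mD mA; rewrite [RHS](measure_splitI _ mA mD).
rewrite [X in _ = _ + X](_ : _ = 0) ?adde0//.
have mDC := measurableC mD.
apply: (subset_measure0 _ mDC _ (bm_off mu)); last by move=> x [].
exact: measurableI.
Qed.

Section countable_bigcup.
Variables (I : countType) (P : set I) (F : I -> set T).
Hypothesis mF : forall i, measurable (F i).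

Lemma countable_bigcup_measurable : measurable (\bigcup_(i in P) F i).
Proof.
rewrite bigcup_mkcond; apply: countable_bigcupT_measurable => // i.
by case: ifP.
Qed.

Lemma null_countable_bigcup mu : (forall i, P i -> mu (F i) = 0) ->
  mu (\bigcup_(i in P) F i) = 0.
Proof.
move=> F0; apply: measure_negligible; first exact: countable_bigcup_measurable.
pose G n := if unpickle n is Some i then if i \in P then F i else set0 else set0.
apply: (@negligibleS _ _ _ _ (\bigcup_n G n)).
  move=> x [i Pi Fix]; exists (pickle i) => //.
  by rewrite /G pickleK; case: ifPn => //; rewrite notin_setE.
apply: negligible_bigcup => n; rewrite /G.
case: (unpickle n) => [i|]; last exact: negligible_set0.
case: ifPn => [/set_mem Pi|_]; last exact: negligible_set0.
by apply/negligibleP => //; exact: F0.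
Qed.

End countable_bigcup.

End finite_measures.

Section rays.
Variable R : realType.
Implicit Types x y : R.

Definition ray x : set R := `]-oo, x]%classic.

Lemma measurable_ray x : measurable (ray x). Proof. exact: measurable_itv. Qed.

Lemma setC_ray x : ~` ray x = `]x, +oo[%classic.
Proof. by rewrite /ray setCitvl. Qed.

Lemma ray_sub x y : (x <= y)%R -> ray x `<=` ray y.
Proof. by move=> xy z; rewrite /ray/= !in_itv/= => /le_trans; exact. Qed.

Lemma ray_split x y : (x <= y)%R -> ray y = ray x `|` `]x, y]%classic.
Proof.
move=> xy; apply/seteqP; split => z; rewrite /ray/= !in_itv/=.
  by move=> ->; rewrite andbT; have [|] := leP z x; [left|right].
by move=> [zx|/andP[]//]; rewrite (le_trans zx).
Qed.

Lemma ray_split0 x y : ray x `&` `]x, y]%classic = set0.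
Proof.
rewrite -subset0 => z []; rewrite /ray/= !in_itv/= => zx /andP[xz _].
by lra.
Qed.

Lemma measurable_sub_ray :
  @measurable _ R `<=` <<s [set A | exists x, A = ray x] >>.
Proof.
move=> A.
have -> : @measurable _ R A = (@RGenOInfty.G R).-sigma.-measurable A.
  by rewrite -RGenOInfty.measurableE.
apply: smallest_sub; first exact: smallest_sigma_algebra.
move=> _ [x ->]; rewrite -setC_ray -setTD.
by apply: sigma_algebraCD; apply: sub_sigma_algebra; exists x.
Qed.

Lemma finite_measure_eq (mu nu : {finite_measure set R -> \bar R}) :
  (forall x, mu (ray x) = nu (ray x)) ->
  forall A, measurable A -> mu A = nu A.
Proof.
move=> munu A /measurable_sub_ray.
apply: (@g_sigma_algebra_measure_unique _ _ _ _ _ (fun k => ray k%:R)) => //.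
- by move=> _ [x ->]; exact: measurable_ray.
- by move=> k; exists k%:R.
- apply/seteqP; split => // x _; exists (Num.truncn `|x|).+1 => //=.
  rewrite /ray/= in_itv/=; apply/ltW/(le_lt_trans (ler_norm x)).
  by have /andP[] := Num.Theory.truncn_itv (normr_ge0 x).
- move=> _ _ [x ->] [y ->]; exists (Num.min x y).
  by apply/seteqP; split => z; rewrite /ray/= !in_itv/= le_min => /andP.
- by move=> _ [x ->]; exact: munu.
- by move=> k; rewrite -ge0_fin_numE// fin_num_measure//; exact: measurable_ray.
Qed.

Lemma meas1_eq (mu nu : meas1 R) :
  (forall x, mu (ray x) = nu (ray x)) -> mu = nu.
Proof. by move=> /finite_measure_eq; exact: bmeasure_eq. Qed.

Lemma measurable_rectangle (A B : set R) :
  measurable A -> measurable B -> measurable (A `*` B).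
Proof. exact: measurableX. Qed.

Lemma marginal1E (p : meas2 R) A : measurable A ->
  marginal1 p A = p (A `*` setT).
Proof.
move=> mA; rewrite bmeasure_imageE//; congr (p _).
by apply/seteqP; split => [z ?|z []].
Qed.

Lemma marginal2E (p : meas2 R) A : measurable A ->
  marginal2 p A = p (setT `*` A).
Proof.
move=> mA; rewrite bmeasure_imageE//; congr (p _).
by apply/seteqP; split => [z ?|z []].
Qed.

(** The uniqueness on the line is used once per coordinate: freezing one factor
    of a rectangle leaves a marginal of a restriction, which is a measure on the
    line. *)
Lemma meas2_eq (p q : meas2 R) :
  (forall x y, p (ray x `*` ray y) = q (ray x `*` ray y)) -> p = q.
Proof.
move=> pq.
have mX := measurable_rectangle.
have pq1 A y : measurable A -> p (A `*` ray y) = q (A `*` ray y).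
  move=> mA; have mTy := mX _ _ measurableT (measurable_ray y).
  pose r (s : meas2 R) := marginal1 (bmeasure_restr s mTy (@measurable_unit_square R)).
  have rE s B : measurable B -> r s B = s (B `*` ray y).
    move=> mB; rewrite marginal1E// bmeasure_restrE; last exact: mX.
    by rewrite -setXI setIT setTI.
  suff : r p = r q by move=> /(congr1 (fun s : meas1 R => s A)); rewrite !rE.
  by apply: meas1_eq => x; rewrite !rE//; exact: measurable_ray.
have pq2 A B : measurable A -> measurable B -> p (A `*` B) = q (A `*` B).
  move=> mA mB; have mAT := mX _ _ mA measurableT.
  pose r (s : meas2 R) := marginal2 (bmeasure_restr s mAT (@measurable_unit_square R)).
  have rE s C : measurable C -> r s C = s (A `*` C).
    move=> mC; rewrite marginal2E// bmeasure_restrE; last exact: mX.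
    by rewrite -setXI setIT setTI.
  suff : r p = r q by move=> /(congr1 (fun s : meas1 R => s B)); rewrite !rE.
  by apply: meas1_eq => x; rewrite !rE ?pq1//; exact: measurable_ray.
apply: bmeasure_eq => A mA.
apply: (@measure_unique _ _ _ [set A `*` B | A in measurable & B in measurable]
  (fun=> setT)) => //.
- exact: measurable_prod_measurableType.
- move=> _ _ [A1 mA1 [B1 mB1 <-]] [A2 mA2 [B2 mB2 <-]].
  exists (A1 `&` A2); first exact: measurableI.
  by exists (B1 `&` B2); [exact: measurableI|rewrite setXI].
- by move=> _; exists setT => //; exists setT => //; rewrite setXTT.
- by rewrite bigcup_const//; exists 0%N.
- by move=> _ [A1 mA1 [B1 mB1 <-]]; exact: pq2.
- by move=> _; rewrite -ge0_fin_numE// fin_num_measure.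
Qed.

End rays.

Section supports.
Variable R : realType.
Implicit Types p q : meas2 R.

Let qbox (k : rat * rat * (rat * rat)) : set (R * R) :=
  `]ratr k.1.1, ratr k.1.2[%classic `*` `]ratr k.2.1, ratr k.2.2[%classic.

Let measurable_qbox k : measurable (qbox k).
Proof. by apply: measurableX; exact: measurable_itv. Qed.

Lemma open_setX (A B : set R) : open A -> open B -> open (A `*` B).
Proof.
move=> oA oB; rewrite openE => -[x y] [/= Ax By].
by exists (A, B) => //; split; apply: open_nbhs_nbhs.
Qed.

Let open_qbox k : open (qbox k).
Proof. by apply: open_setX; exact: interval_open. Qed.

(** The Borel sets of the plane are here the product sigma-algebra; a countable
    base of boxes is what relates it to the open sets. *)
Let qbox_basis (U : set (R * R)) z : open U -> U z ->
  exists2 k, qbox k z & qbox k `<=` U.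
Proof.
move=> oU Uz.
have [[A B] /= [zA zB] ABU] : nbhs z U by apply: open_nbhs_nbhs.
have H (a : R) (V : set R) : nbhs a V ->
    exists2 k : rat * rat, `]ratr k.1, ratr k.2[%classic a &
      `]ratr k.1, ratr k.2[%classic `<=` V.
  move=> /nbhs_ballP[e /= e0 aV].
  have [r1] : exists r : rat, ratr r \in `]a - e, a[%R.
    by apply: rat_in_itvoo; rewrite ltrBlDr ltrDl.
  have [r2] : exists r : rat, ratr r \in `]a, a + e[%R.
    by apply: rat_in_itvoo; rewrite ltrDl.
  rewrite !in_itv/= => /andP[ar2 r2a] /andP[ar1 r1a].
  exists (r1, r2); rewrite /= ?in_itv/= ?r1a//.
  move=> x; rewrite /= in_itv/= => /andP[r1x xr2]; apply: aV.
  by rewrite /ball/= ltr_norml; apply/andP; split; lra.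
have [k1 zk1 k1A] := H _ _ zA.
have [k2 zk2 k2B] := H _ _ zB.
exists (k1, k2); first by split.
by move=> w [w1 w2]; apply: ABU; split; [exact: k1A|exact: k2B].
Qed.

Lemma open2_measurable (U : set (R * R)) : open U -> measurable U.
Proof.
move=> oU; rewrite (_ : U = \bigcup_(k in [set k | qbox k `<=` U]) qbox k).
  exact: countable_bigcup_measurable.
apply/seteqP; split => [z Uz|z [k kU kz]]; last exact: kU.
by have [k zk kU] := qbox_basis oU Uz; exists k.
Qed.

Lemma closed2_measurable (C : set (R * R)) : closed C -> measurable C.
Proof.
move=> cC; rewrite -(setCK C); apply: measurableC.
by apply: open2_measurable; exact: closed_openC.
Qed.

Lemma msupport_compl p z : ~ msupport p z ->
  exists U, [/\ open U, U z & p U = 0].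
Proof.
move=> /existsNP[U /not_implyP[oU /not_implyP[Uz /negP pU]]].
by exists U; split => //; apply/eqP; rewrite eq_le measure_ge0 andbT leNgt.
Qed.

Lemma measurable_msupport p : measurable (msupport p).
Proof.
apply: closed2_measurable; rewrite -openC openE => z.
move=> /msupport_compl[U [oU Uz pU]].
apply: (@filterS _ (nbhs z) _ U); last exact: open_nbhs_nbhs.
by move=> w Uw /(_ U oU Uw); rewrite pU ltxx.
Qed.

(** The complement of the support is the union of the rational boxes that are
    null, and there are countably many of them. *)
Lemma null_compl_msupport p : p (~` msupport p) = 0.
Proof.
rewrite (_ : ~` _ = \bigcup_(k in [set k | p (qbox k) = 0]) qbox k).
  exact: null_countable_bigcup.
apply/seteqP; split => [z /msupport_compl[U [oU Uz pU]]|z [k pk kz]]; last first.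
  by move=> /(_ _ (@open_qbox k) kz); rewrite pk ltxx.
have [k kz kU] := qbox_basis oU Uz; exists k => //.
exact: subset_measure0 (@measurable_qbox k) (open2_measurable oU) kU pU.
Qed.

Lemma msupport_disjoint p (A : set (R * R)) : measurable A ->
  (forall z, A z -> ~ msupport p z) -> p A = 0.
Proof.
move=> mA AS; apply: subset_measure0 mA _ AS (null_compl_msupport p).
by apply: measurableC; exact: measurable_msupport.
Qed.

Lemma msupport_open_null p (U : set (R * R)) : open U -> p U = 0 ->
  forall z, msupport p z -> ~ U z.
Proof. by move=> oU U0 z /(_ _ oU) pU /pU; rewrite U0 ltxx. Qed.

Lemma sub_msupport p q : bmeasure_le p q -> msupport p `<=` msupport q.
Proof.
move=> pq z pz U oU Uz; apply: lt_le_trans (pz U oU Uz) _.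
by apply: pq; exact: open2_measurable.
Qed.

End supports.

(** * Monotone couplings *)

Section nearrow_characterization.
Variable R : realType.
Implicit Types (p q : meas2 R) (x y : R).

Lemma nondecreasing_setP (S : set (R * R)) :
  nondecreasing_set S <->
  (forall z w, S z -> S w -> (z.1 < w.1)%R -> (w.2 < z.2)%R -> False).
Proof.
split=> [ndS z w Sz Sw zw1 wz2|noinv z w Sz Sw].
  by have := ndS _ _ Sz Sw; nra.
have [zw1|wz1|->] := ltgtP z.1 w.1; last by rewrite subrr mul0r.
- have [wz2|zw2] := ltP w.2 z.2; first by case: (noinv z w).
  by nra.
- have [zw2|wz2] := ltP z.2 w.2; first by case: (noinv w z).
  by nra.
Qed.

(** Two support points in the two opposite quadrants at (x, y) form an inversion;
    conversely an inversion is separated by the midpoint of its two points. *)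
Lemma nondecreasing_msupportP p :
  nondecreasing_set (msupport p) <->
  (forall x y, p (ray x `*` ~` ray y) = 0 \/ p (~` ray x `*` ray y) = 0).
Proof.
split=> [/nondecreasing_setP ndp x y|p0].
  apply: contrapT => /not_orP[]; rewrite !setC_ray => p1 p2.
  have [z [Az Sz]] : exists z, (ray x `*` `]y, +oo[) z /\ msupport p z.
    apply: contrapT => /forallNP H; apply: p1; apply: msupport_disjoint.
      by apply: measurable_rectangle; exact: measurable_itv.
    by move=> z Az Sz; exact: (H z).
  have [w [Aw Sw]] : exists w, (`]x, +oo[ `*` ray y) w /\ msupport p w.
    apply: contrapT => /forallNP H; apply: p2; apply: msupport_disjoint.
      by apply: measurable_rectangle; exact: measurable_itv.
    by move=> w Aw Sw; exact: (H w).
  move: Az Aw; rewrite /ray/= !in_itv/= !andbT => -[zx yz] [xw wy].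
  by apply: (ndp z w) => //; [exact: le_lt_trans xw|exact: le_lt_trans yz].
apply/nondecreasing_setP => z w Sz Sw zw1 wz2.
pose x := ((z.1 + w.1) / 2)%R; pose y := ((z.2 + w.2) / 2)%R.
have [zx xw] : (z.1 < x)%R /\ (x < w.1)%R by rewrite /x; split; lra.
have [wy yz] : (w.2 < y)%R /\ (y < z.2)%R by rewrite /y; split; lra.
have [] := p0 x y; rewrite !setC_ray => {}p0.
  apply: (@msupport_open_null _ p (`]-oo, x[ `*` `]y, +oo[) _ _ z Sz).
  - by apply: open_setX; exact: interval_open.
  - apply: subset_measure0 p0; try by apply: measurable_rectangle; exact: measurable_itv.
    by move=> v [v1 v2]; split => //; move: v1; rewrite /ray/= !in_itv/=; exact: ltW.
  - by split; rewrite /= in_itv/= ?andbT.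
apply: (@msupport_open_null _ p (`]x, +oo[ `*` `]-oo, y[) _ _ w Sw).
- by apply: open_setX; exact: interval_open.
- apply: subset_measure0 p0; try by apply: measurable_rectangle; exact: measurable_itv.
  by move=> v [v1 v2]; split => //; move: v2; rewrite /ray/= !in_itv/=; exact: ltW.
- by split; rewrite /= in_itv/= ?andbT.
Qed.

Lemma measure_setXC p (A B : set R) : measurable A -> measurable B ->
  p (A `*` setT) = p (A `*` B) + p (A `*` ~` B).
Proof.
move=> mA mB; have mX := @measurable_rectangle R.
rewrite (@measure_splitI _ _ _ p _ (setT `*` B)) //; [|exact: mX|exact: mX].
congr (p _ + p _).
  by rewrite -setXI setIT setTI.
apply/seteqP; split=> [z [[? _] zB]|z [? zB]]; split=> //.
  by move=> Bz; apply: zB.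
by case=> _; exact: zB.
Qed.

Lemma measure_setCX p (A B : set R) : measurable A -> measurable B ->
  p (setT `*` B) = p (A `*` B) + p (~` A `*` B).
Proof.
move=> mA mB; have mX := @measurable_rectangle R.
rewrite (@measure_splitI _ _ _ p _ (A `*` setT)) //; [|exact: mX|exact: mX].
congr (p _ + p _).
  by rewrite -setXI setIT setTI.
apply/seteqP; split=> [z [[_ ?] zA]|z [zA ?]]; split=> //.
  by move=> Az; apply: zA.
by case=> Az _; exact: zA.
Qed.

(** One of the two quadrants that complete ray x * ray y to a half-plane is null,
    so the mass of ray x * ray y is that of a half-plane, and it never exceeds
    that of the other one. *)
Lemma nondecreasing_quadrant p x y : nondecreasing_set (msupport p) ->
  p (ray x `*` ray y) = mine (marginal1 p (ray x)) (marginal2 p (ray y)).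
Proof.
move=> /nondecreasing_msupportP/(_ x y).
have mr := @measurable_ray R.
rewrite marginal1E// marginal2E// (@measure_setXC p _ (ray y))//.
rewrite (@measure_setCX p (ray x))//.
move=> [->|->]; rewrite adde0.
  by rewrite min_l// leeDl.
by rewrite min_r// leeDl.
Qed.

Lemma nondecreasing_coupling_unique p q :
  nondecreasing_set (msupport p) -> nondecreasing_set (msupport q) ->
  marginals p = marginals q -> p = q.
Proof.
move=> ndp ndq /pair_equal_spec[e1 e2]; apply: meas2_eq => x y.
by rewrite !nondecreasing_quadrant// e1 e2.
Qed.

Lemma nearrow_marginals p : nondecreasing_set (msupport p) ->
  nearrow (marginal1 p) (marginal2 p) = p.
Proof.
move=> ndp; rewrite /nearrow.
set Q := (X in get X); have [] : Q (get Q) by apply: getPex; exists p.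
move=> e1 e2 ndq; apply: nondecreasing_coupling_unique => //.
exact: (f_equal2 pair e1 e2).
Qed.

End nearrow_characterization.

(** * Existence of the monotone coupling *)

Section quantile.
Variable R : realType.
Implicit Types (mu nu : meas1 R) (x y t : R).

Definition mcdf mu x : R := fine (mu (ray x)).

Lemma mcdfE mu x : (mcdf mu x)%:E = mu (ray x).
Proof. by rewrite fineK// fin_num_measure//; exact: measurable_ray. Qed.

Lemma mcdf_homo mu x y : (x <= y)%R -> (mcdf mu x <= mcdf mu y)%R.
Proof.
move=> xy; rewrite -lee_fin !mcdfE le_measure ?inE//; try exact: measurable_ray.
exact: ray_sub.
Qed.

Lemma ray_setI_lt0 x : (x < 0)%R -> ray x `&` @unit_interval R = set0.
Proof.
move=> x0; rewrite -subset0 => z []; rewrite /ray/unit_interval/= !in_itv/= => zx /andP[z0 _].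
by lra.
Qed.

Lemma ray_setI_ge1 x : (1 <= x)%R -> ray x `&` @unit_interval R = @unit_interval R.
Proof.
move=> x1; apply/setIidPr => z; rewrite /ray/unit_interval/= !in_itv/= => /andP[_ z1].
by lra.
Qed.

Lemma meas1_ray_lt0 mu x : (x < 0)%R -> mu (ray x) = 0.
Proof.
move=> x0; rewrite -(bmeasure_setI mu (@measurable_unit_interval R))//; last exact: measurable_ray.
by rewrite ray_setI_lt0// measure0.
Qed.

Lemma meas1_setT mu : mu setT = mu (@unit_interval R).
Proof.
by rewrite -[LHS](bmeasure_setI mu (@measurable_unit_interval R))// setTI.
Qed.

Lemma meas1_ray_ge1 mu x : (1 <= x)%R -> mu (ray x) = mu setT.
Proof.
move=> x1; rewrite -[LHS](bmeasure_setI mu (@measurable_unit_interval R))//; last exact: measurable_ray.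
by rewrite ray_setI_ge1// meas1_setT.
Qed.

(** Right continuity of the distribution function: without it the quantile of t
    could equal x while mcdf mu x < t. *)
Lemma mcdf_right mu x t : (mcdf mu x < t)%R ->
  exists2 y, (x < y)%R & (mcdf mu y < t)%R.
Proof.
move=> xt; apply: contrapT => H.
have {}H y : (x < y)%R -> (t <= mcdf mu y)%R.
  by move=> xy; rewrite leNgt; apply/negP => yt; apply: H; exists y.
have cvx : mu (ray (x + n.+1%:R^-1)) @[n --> \oo] --> mu (ray x).
  have -> : ray x = \bigcap_n ray (x + n.+1%:R^-1) by exact: itvNycEbigcap.
  apply: nonincreasing_cvg_mu.
  - by rewrite -ge0_fin_numE// fin_num_measure//; exact: measurable_ray.
  - by move=> n; exact: measurable_ray.
  - by apply: bigcap_measurable => // n _; exact: measurable_ray.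
  - move=> m n mn; apply/subsetPset; apply: ray_sub.
    by rewrite lerD2l lef_pV2 ?posrE// ler_nat.
move: xt; rewrite ltNge => /negP; apply; rewrite -lee_fin mcdfE -(cvg_lim _ cvx)//.
apply: lime_ge; first by apply/cvg_ex; eexists; exact: cvx.
by apply: nearW => n; rewrite -mcdfE lee_fin H// ltrDl invr_gt0.
Qed.

(** The left-continuous inverse of the distribution function. Taking a supremum
    over a set that always contains 0 and is bounded by 1 makes it monotone, with
    values in the unit interval, for every real t. *)
Definition quantile mu t : R :=
  sup [set x | x = 0%R \/ (x <= 1)%R /\ (mcdf mu x < t)%R].

Let qset mu t : set R := [set x | x = 0%R \/ (x <= 1)%R /\ (mcdf mu x < t)%R].

Let qset_has_sup mu t : has_sup (qset mu t).
Proof. by split; [exists 0%R; left|exists 1%R => z [->//|[]//]]. Qed.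

Lemma quantile_ge0 mu t : (0 <= quantile mu t)%R.
Proof. by apply: ub_le_sup; [exact: (qset_has_sup mu t).2|left]. Qed.

Lemma quantile_le1 mu t : (quantile mu t <= 1)%R.
Proof. by apply: ge_sup; [exact: (qset_has_sup mu t).1|move=> z [->//|[]//]]. Qed.

Lemma quantile_homo mu : nondecreasing_fun (quantile mu).
Proof.
move=> s t st; apply: ge_sup; first exact: (qset_has_sup mu s).1.
move=> z Sz; apply: ub_le_sup; first exact: (qset_has_sup mu t).2.
by case: Sz => [->|[z1 zs]]; [left|right; split=> //; exact: lt_le_trans st].
Qed.

(** The Galois connection between a distribution function and its inverse. *)
Lemma quantile_le mu t x : (0 < t)%R -> (t%:E <= mu setT) ->
  (quantile mu t <= x)%R = (t <= mcdf mu x)%R.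
Proof.
move=> t0 tmu; apply/idP/idP => [qx|tx].
  rewrite leNgt; apply/negP => xt.
  have x1 : (x < 1)%R.
    rewrite ltNge; apply/negP => x1; move: xt; rewrite -lte_fin mcdfE.
    by rewrite meas1_ray_ge1// ltNge tmu.
  have [y xy yt] := mcdf_right xt.
  (* y itself may exceed 1 and then is not in the set defining the quantile *)
  suff : (Num.min y 1 <= quantile mu t)%R.
    by move=> /le_trans/(_ qx); rewrite leNgt lt_min xy x1.
  apply: ub_le_sup; first exact: (qset_has_sup mu t).2.
  right; split; first by rewrite ge_min lexx orbT.
  by apply: le_lt_trans yt; apply: mcdf_homo; rewrite ge_min lexx.
apply: ge_sup; first exact: (qset_has_sup mu t).1.
move=> z [->|[_ zt]].
  rewrite leNgt; apply/negP => x0; move: tx.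
  by rewrite -lee_fin mcdfE meas1_ray_lt0// lee_fin leNgt t0.
rewrite leNgt; apply/negP => xz; have := mcdf_homo mu (ltW xz).
by rewrite leNgt (lt_le_trans zt tx).
Qed.

Lemma measurable_quantile mu : measurable_fun setT (quantile mu).
Proof. by apply: nondecreasing_measurable => //; exact: quantile_homo. Qed.

End quantile.

Section lebesgue_initial_segment.
Variables (R : realType) (M : R).

Let I : set R := `]0%R, M]%classic.
Let mI : measurable I. Proof. exact: measurable_itv. Qed.
Local Notation r := (mrestr (@lebesgue_measure R) mI).

Let r_fin A : measurable A -> r A \is a fin_num.
Proof.
move=> mA; rewrite ge0_fin_numE//.
apply: (@le_lt_trans _ _ (lebesgue_measure I)).
  by apply: le_measure; rewrite ?inE//; exact: measurableI.
by rewrite /I lebesgue_measure_itv/=; case: ifPn => _; rewrite ltry.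
Qed.

Let r_off : r (~` I) = 0.
Proof. by rewrite /mrestr setICl measure0. Qed.

(** The parameter space of the monotone coupling; M will be the common mass of its
    two marginals. *)
Definition lebesgue_segment : bmeasure R I :=
  @make_bmeasure _ R R I r (measure0 r)
    (fun A _ => measure_ge0 r A) r_fin (@measure_semi_sigma_additive _ _ _ r)
    r_off.

Lemma lebesgue_segmentE A : measurable A ->
  lebesgue_segment A = lebesgue_measure (A `&` I).
Proof. by move=> mA; rewrite make_bmeasureE. Qed.

End lebesgue_initial_segment.

Section nearrow_exists.
Variable R : realType.
Variables mu nu : meas1 R.
Hypothesis munu : mu setT = nu setT.

Let M : R := fine (mu setT).

Let ME : M%:E = mu setT.
Proof. by rewrite fineK// fin_num_measure. Qed.

Let q t : R * R := (quantile mu t, quantile nu t).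

Let mq : measurable_fun setT q.
Proof. by apply: measurable_fun_pair; exact: measurable_quantile. Qed.

Let q_square : `]0%R, M]%classic `<=` q @^-1` (@unit_square R).
Proof.
by move=> t _; split; rewrite /unit_interval/= in_itv/= quantile_ge0 quantile_le1.
Qed.

Let p : meas2 R := bmeasure_image (lebesgue_segment M) mq
  (@measurable_unit_square R) (measurable_itv _) q_square.

Let pE A : measurable A ->
  p A = lebesgue_measure (q @^-1` A `&` `]0%R, M]%classic).
Proof.
move=> mA; rewrite bmeasure_imageE// lebesgue_segmentE//.
by rewrite -[X in measurable X]setTI; exact: mq.
Qed.

Let quantile_mu t x : `]0%R, M]%classic t ->
  ray x (quantile mu t) <-> (t <= mcdf mu x)%R.
Proof.
rewrite /ray/= !in_itv/= => /andP[t0 tM].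
by rewrite quantile_le// -ME lee_fin.
Qed.

Let quantile_nu t x : `]0%R, M]%classic t ->
  ray x (quantile nu t) <-> (t <= mcdf nu x)%R.
Proof.
rewrite /ray/= !in_itv/= => /andP[t0 tM].
by rewrite quantile_le// -munu -ME lee_fin.
Qed.

Let lebesgue_initial (a : R) : (0 <= a <= M)%R ->
  lebesgue_measure [set t | `]0%R, M]%classic t /\ (t <= a)%R] = a%:E.
Proof.
move=> /andP[a0 aM]; rewrite (_ : [set t | _] = `]0%R, a]%classic).
  rewrite lebesgue_measure_itv/= lte_fin; case: ltP => a0'; first by rewrite oppr0 adde0.
  by congr EFin; apply/eqP; rewrite eq_le a0.
apply/seteqP; split => t /=; rewrite !in_itv/=.
  by move=> [/andP[-> _] ->].
by move=> /andP[-> ta]; rewrite ta (le_trans ta).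
Qed.

(** Pushing Lebesgue measure forward along t |-> (quantile mu t, quantile nu t):
    both coordinates increase with t. Concretely, the quadrant ray x * ~` ray y
    pulls back to cdf nu y < t <= cdf mu x and the opposite one to
    cdf mu x < t <= cdf nu y, and one of these is empty. *)
Lemma nearrow_exists : exists p : meas2 R,
  [/\ marginal1 p = mu, marginal2 p = nu & nondecreasing_set (msupport p)].
Proof.
exists p; have mr := @measurable_ray R; have mX := @measurable_rectangle R; split.
- apply: meas1_eq => x; rewrite marginal1E// pE; last exact: mX.
  rewrite -mcdfE -lebesgue_initial; last first.
    rewrite fine_ge0//= -lee_fin mcdfE ME le_measure ?inE//.
  congr (_ _); apply/seteqP; split => t.
    by move=> [[/= tx _] tM]; split => //; apply/quantile_mu.
  by move=> [tM tx]; split => //; split => //; apply/quantile_mu.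
- apply: meas1_eq => x; rewrite marginal2E// pE; last exact: mX.
  rewrite -mcdfE -lebesgue_initial; last first.
    by rewrite fine_ge0//= -lee_fin mcdfE ME munu le_measure ?inE//.
  congr (_ _); apply/seteqP; split => t.
    by move=> [[/= _ tx] tM]; split => //; apply/quantile_nu.
  by move=> [tM tx]; split => //; split => //; apply/quantile_nu.
- apply/nondecreasing_msupportP => x y.
  have [xy|/ltW yx] := leP (mcdf mu x) (mcdf nu y); [left|right].
    rewrite pE; last by apply: mX => //; exact: measurableC.
    rewrite (_ : _ `&` _ = set0) ?measure0// -subset0 => t [[/= tx ty] tM].
    by apply: ty; apply/quantile_nu => //; apply: le_trans xy; exact/quantile_mu.
  rewrite pE; last by apply: mX => //; exact: measurableC.
  rewrite (_ : _ `&` _ = set0) ?measure0// -subset0 => t [[/= tx ty] tM].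
  by apply: tx; apply/quantile_mu => //; apply: le_trans yx; exact/quantile_nu.
Qed.

End nearrow_exists.

Lemma nearrowP (R : realType) (mu nu : meas1 R) : mu setT = nu setT ->
  [/\ marginal1 (nearrow mu nu) = mu, marginal2 (nearrow mu nu) = nu
    & nondecreasing_set (msupport (nearrow mu nu))].
Proof.
move=> munu; rewrite /nearrow; set Q := (X in get X).
by have : Q (get Q) by apply: getPex; exact: nearrow_exists.
Qed.

(** * Patterns 321 and supports *)

Section pattern321.
Variable R : realType.
Implicit Types (mu p q : meas2 R) (S : set (R * R)).

Let T := (R * R)%type.

(** The set of the definition of 321-avoidance, named so that its measurability can
    be proved separately. *)
Definition pattern321 : set (T * T * T) :=
  [set z | [/\ (z.1.1.1 < z.1.2.1)%R, (z.1.2.1 < z.2.1)%R,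
               (z.1.1.2 > z.1.2.2)%R & (z.1.2.2 > z.2.2)%R]].

Lemma measurable_pattern321 : measurable pattern321.
Proof.
have mlt (f g : T * T * T -> R) : measurable_fun setT f ->
    measurable_fun setT g -> measurable [set z | (f z < g z)%R].
  move=> mf mg.
  have /(_ measurableT) := @measurable_lte _ (T * T * T)%type R setT.
  move=> /(_ (EFin \o f) (EFin \o g)); rewrite setTI; apply.
  - exact/measurable_EFinP.
  - exact/measurable_EFinP.
pose f1 (z : T * T * T) := z.1.1; pose f2 (z : T * T * T) := z.1.2.
have mf1 : measurable_fun setT f1 by apply: measurableT_comp.
have mf2 : measurable_fun setT f2 by apply: measurableT_comp.
have mf3 : measurable_fun setT (@snd (T * T) T) by exact: measurable_snd.
have mx (f : T * T * T -> T) : measurable_fun setT f ->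
  measurable_fun setT (fun z => (f z).1) by move=> mf; apply: measurableT_comp.
have my (f : T * T * T -> T) : measurable_fun setT f ->
  measurable_fun setT (fun z => (f z).2) by move=> mf; apply: measurableT_comp.
rewrite (_ : pattern321 =
  ([set z | (f1 z).1 < (f2 z).1] `&` [set z | (f2 z).1 < z.2.1]) `&`
  ([set z | (f2 z).2 < (f1 z).2] `&` [set z | z.2.2 < (f2 z).2]))%R.
  apply: measurableI; apply: measurableI; apply: mlt;
    (apply: mx + apply: my); assumption.
by apply/seteqP; split => z /= [] // [? ?] [? ?].
Qed.

Lemma cube_measureE mu (A B C : set T) : measurable A -> measurable B ->
  measurable C -> ((mu \x mu) \x mu) (A `*` B `*` C) = mu A * mu B * mu C.
Proof.
move=> mA mB mC; rewrite product_measure1E//; last exact: measurableX.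
by congr (_ * _); exact: product_measure1E.
Qed.

(** Around three points in decreasing position there are three open boxes whose
    product stays inside the pattern, and each of them has positive mass. *)
Lemma avoids321_msupport mu : avoids321 mu -> forall a b c : T,
  msupport mu a -> msupport mu b -> msupport mu c -> ~ pattern321 (a, b, c).
Proof.
move=> mu321 a b c Sa Sb Sc [/= ab1 bc1 ab2 bc2].
pose x1 := ((a.1 + b.1) / 2)%R; pose x2 := ((b.1 + c.1) / 2)%R.
pose y1 := ((a.2 + b.2) / 2)%R; pose y2 := ((b.2 + c.2) / 2)%R.
pose A : set T := `]-oo, x1[ `*` `]y1, +oo[.
pose B : set T := `]x1, x2[ `*` `]y2, y1[.
pose C : set T := `]x2, +oo[ `*` `]-oo, y2[.
have oA : open A by apply: open_setX; exact: interval_open.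
have oB : open B by apply: open_setX; exact: interval_open.
have oC : open C by apply: open_setX; exact: interval_open.
have Aa : A a by split; rewrite /= in_itv/= ?andbT /x1 /y1; lra.
have Bb : B b by split; rewrite /= in_itv/= /x1 /y1 /x2 /y2; apply/andP; split; lra.
have Cc : C c by split; rewrite /= in_itv/= ?andbT /x2 /y2; lra.
have mA := open2_measurable oA; have mB := open2_measurable oB.
have mC := open2_measurable oC.
have : ((mu \x mu) \x mu) (A `*` B `*` C) = 0.
  apply: subset_measure0 mu321.
  - by apply: measurableX => //; exact: measurableX.
  - exact: measurable_pattern321.
  - move=> [[u v] w] [[/= [u1 u2] [v1 v2]] [w1 w2]].
    move: u1 u2 v1 v2 w1 w2; rewrite /= !in_itv/= !andbT.
    move=> u1 u2 /andP[v1 v2] /andP[v3 v4] w1 w2.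
    by split => /=; lra.
move/eqP; rewrite cube_measureE// gt_eqF//.
by rewrite !mule_gt0//; [exact: Sa|exact: Sb|exact: Sc].
Qed.

(** Pigeonhole: of three points in two nondecreasing sets, two lie in the same
    one, and a 321 pattern makes them an inversion. *)
Lemma nondecreasing_cover_avoids321 mu (S1 S2 : set T) :
  measurable S1 -> measurable S2 ->
  nondecreasing_set S1 -> nondecreasing_set S2 ->
  mu (~` (S1 `|` S2)) = 0 -> avoids321 mu.
Proof.
move=> mS1 mS2 /nondecreasing_setP nd1 /nondecreasing_setP nd2 mu0.
set N := ~` (S1 `|` S2) in mu0.
have mN : measurable N by apply: measurableC; exact: measurableU.
have mTT : measurable [set: T] by exact: measurableT.
apply: (subset_measure0 (B := (N `*` setT `*` setT) `|` (setT `*` N `*` setT)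
    `|` (setT `*` setT `*` N)) measurable_pattern321).
- by do 2?apply: measurableU; do 2?apply: measurableX.
- move=> [[a b] c] [/= ab1 bc1 ab2 bc2].
  have [ac1 ac2] : (a.1 < c.1)%R /\ (c.2 < a.2)%R by split; lra.
  have [|aN] := pselect (N a); first by left; left.
  have [|bN] := pselect (N b); first by left; right.
  have [|cN] := pselect (N c); first by right.
  exfalso; move: aN bN cN => /contrapT aS /contrapT bS /contrapT cS.
  case: aS => aS; case: bS => bS; case: cS => cS;
    by [exact: (nd1 a b)|exact: (nd1 a c)|exact: (nd1 b c)
       |exact: (nd2 a b)|exact: (nd2 a c)|exact: (nd2 b c)].
- apply: null_set_setU; first by apply: measurableU; do 2?apply: measurableX.
  + by do 2?apply: measurableX.
  + apply: null_set_setU; try by do 2?apply: measurableX.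
      by apply: etrans (cube_measureE _ mN mTT mTT) _; rewrite mu0 !mul0e.
    by apply: etrans (cube_measureE _ mTT mN mTT) _; rewrite mu0 mule0 mul0e.
  + by apply: etrans (cube_measureE _ mTT mTT mN) _; rewrite mu0 mule0.
Qed.

End pattern321.

Section permuton321_support.
Variable R : realType.
Implicit Types (mu : meas2 R).

Lemma leb_set1 (x : R) : leb R [set x] = 0.
Proof.
rewrite lebE//; apply: subset_measure0 (lebesgue_measure_set1 x) => //.
by apply: measurableI => //; exact: measurable_unit_interval.
Qed.

(** Uniform marginals turn an empty corner into an estimate on the opposite
    corner: the mass of A * B is then leb A, and the whole horizontal strip of
    height B weighs leb B <= leb A, which leaves nothing for ~` A * B. *)
Lemma permuton_corner mu (A B : set R) : permuton mu ->
  measurable A -> measurable B -> leb R B <= leb R A ->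
  mu (A `*` ~` B) = 0 -> mu (~` A `*` B) = 0.
Proof.
move=> [_ mu1 mu2] mA mB; rewrite -[in X in X <= _]mu2 -[in X in _ <= X]mu1.
rewrite marginal1E// marginal2E// (measure_setXC _ mA mB) (measure_setCX _ mA mB).
move=> + AB0; rewrite AB0 adde0 => le.
apply/eqP; rewrite eq_le measure_ge0 andbT -(leeD2lE (x := mu (A `*` B))).
  by rewrite adde0.
by rewrite fin_num_measure//; exact: measurable_rectangle.
Qed.

(** No support point lies up and to the left of z, since with z and w it would form
    a 321 pattern. If moreover z.2 <= z.1, the corner estimate empties the region
    down and to the right of z, which contains w. The argument for w is the mirror
    image, with the corner down and to the right of w. *)
Lemma permuton321_inversion mu : permuton321 mu -> forall z w,
  msupport mu z -> msupport mu w -> (z.1 < w.1)%R -> (w.2 < z.2)%R ->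
  (z.1 < z.2)%R /\ (w.2 < w.1)%R.
Proof.
move=> [pmu mu321] z w Sz Sw zw1 wz2.
have no321 := avoids321_msupport mu321.
have mX := @measurable_rectangle R.
split; rewrite ltNge; apply/negP => le.
- have : mu (~` `]-oo, z.1[ `*` `]-oo, z.2]) = 0.
    apply: permuton_corner => //.
      (* leb has no atoms, so the open ray below z.1 weighs as much as ray z.1 *)
      rewrite -[leRHS]adde0 -(leb_set1 z.1) -measureU//; last first.
        rewrite -subset0 => x [] /=; rewrite in_itv/= => /[swap] ->.
        by rewrite ltxx.
      apply: le_measure; rewrite ?inE//; first exact: measurableU.
      move=> x; rewrite /= !in_itv/= => xz2.
      by have [xz1|] := ltP x z.1; [left|move=> ?; right; lra].
    rewrite setCitvl; apply: msupport_disjoint; first exact: mX.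
    move=> v [/= v1 v2] Sv; apply: (no321 v z w) => //.
    by split => //=; move: v1 v2; rewrite !in_itv/= ?andbT.
  move=> mu0; apply: (msupport_open_null (p := mu) (U := `]z.1, +oo[ `*` `]-oo, z.2[) _ _ Sw).
  + by apply: open_setX; exact: interval_open.
  + apply: subset_measure0 mu0.
    * exact: mX.
    * by apply: mX => //; exact: measurableC.
    * move=> v [] /=; rewrite !in_itv/= !andbT => v1 v2; split => /=.
        by apply/negP; rewrite -leNgt ltW.
      exact: ltW.
  + by split; rewrite /= in_itv/= ?andbT.
- have : mu (~` `]w.1, +oo[ `*` `[w.2, +oo[) = 0.
    apply: permuton_corner => //.
      rewrite -[leRHS]adde0 -(leb_set1 w.1) -measureU//; last first.
        rewrite -subset0 => x [] /=; rewrite in_itv/= => /[swap] ->.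
        by rewrite ltxx.
      apply: le_measure; rewrite ?inE//; first exact: measurableU.
      move=> x; rewrite /= !in_itv/= !andbT => xw2.
      by have [xw1|] := ltP w.1 x; [left|move=> ?; right; lra].
    rewrite setCitvr; apply: msupport_disjoint; first exact: mX.
    move=> v [/= v1 v2] Sv; apply: (no321 z w v) => //.
    by split => //=; move: v1 v2; rewrite !in_itv/= ?andbT.
  move=> mu0; apply: (msupport_open_null (p := mu) (U := `]-oo, w.1[ `*` `]w.2, +oo[) _ _ Sz).
  + by apply: open_setX; exact: interval_open.
  + apply: subset_measure0 mu0.
    * exact: mX.
    * by apply: mX => //; exact: measurableC.
    * move=> v [] /=; rewrite !in_itv/= !andbT => v1 v2; split => /=.
        by apply/negP; rewrite -leNgt ltW.
      exact: ltW.
  + by split; rewrite /= in_itv/= ?andbT.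
Qed.

Lemma permuton321_below mu : permuton321 mu ->
  nondecreasing_set (msupport mu `&` [set z | (z.2 <= z.1)%R]).
Proof.
move=> mu321; apply/nondecreasing_setP => z w [Sz /= zle] [Sw _] zw1 wz2.
have [] := permuton321_inversion mu321 Sz Sw zw1 wz2.
by rewrite ltNge zle.
Qed.

Lemma permuton321_above mu : permuton321 mu ->
  nondecreasing_set (msupport mu `&` [set z | (z.1 <= z.2)%R]).
Proof.
move=> mu321; apply/nondecreasing_setP => z w [Sz _] [Sw /= wle] zw1 wz2.
have [_] := permuton321_inversion mu321 Sz Sw zw1 wz2.
by rewrite ltNge wle.
Qed.

End permuton321_support.

(** * The two sides of the diagonal and the fibres of Psi *)

Section diagonal_sides.
Variable R : realType.
Implicit Types (p q mu nu : meas2 R).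

Definition above : set (R * R) := [set z | (z.1 < z.2)%R].
Definition below : set (R * R) := [set z | (z.2 < z.1)%R].
Definition diag : set (R * R) := [set z | z.1 = z.2].

(** A rational between the coordinates of a point off the diagonal separates it
    from the diagonal: this gives both the openness of the two sides and a way to
    see that they are null by countably many rectangles. *)
Lemma aboveE : above =
  \bigcup_(r : rat) (`]-oo, ratr r[ `*` `]ratr r, +oo[).
Proof.
apply/seteqP; split => [z /= /rat_in_itvoo[r]|z [r _] []]; rewrite /= !in_itv/=.
  by move=> /andP[zr rz]; exists r => //; split; rewrite /= in_itv/= ?andbT.
by rewrite andbT; exact: lt_trans.
Qed.

Lemma belowE : below =
  \bigcup_(r : rat) (`]ratr r, +oo[ `*` `]-oo, ratr r[).
Proof.
apply/seteqP; split => [z /= /rat_in_itvoo[r]|z [r _] []]; rewrite /= !in_itv/=.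
  by move=> /andP[zr rz]; exists r => //; split; rewrite /= in_itv/= ?andbT.
by rewrite andbT => /[swap]; exact: lt_trans.
Qed.

Lemma open_above : open above.
Proof.
by rewrite aboveE; apply: bigcup_open => r _; apply: open_setX; exact: interval_open.
Qed.

Lemma open_below : open below.
Proof.
by rewrite belowE; apply: bigcup_open => r _; apply: open_setX; exact: interval_open.
Qed.

Lemma measurable_above : measurable above.
Proof. by apply: open2_measurable; exact: open_above. Qed.

Lemma measurable_below : measurable below.
Proof. by apply: open2_measurable; exact: open_below. Qed.

Lemma fin_num_add_le (x y : \bar R) : x \is a fin_num -> 0 <= y ->
  x + y <= x -> y = 0.
Proof.
move=> xfin y0 xyx; apply/eqP; rewrite eq_le y0 andbT.
by rewrite -(leeD2lE (x := x))// adde0.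
Qed.

(** Here the minimum of the distribution functions at (r, r) is the first one, so
    all the mass of the strip over ray r is below height r. *)
Lemma nondecreasing_above0 p : nondecreasing_set (msupport p) ->
  (forall x, marginal1 p (ray x) <= marginal2 p (ray x)) -> p above = 0.
Proof.
move=> ndp le12; rewrite aboveE.
have mr := @measurable_ray R; have mX := @measurable_rectangle R.
apply: null_countable_bigcup => [r|r _]; first exact: mX.
apply: (@subset_measure0 _ _ _ _ _ (ray (ratr r) `*` ~` ray (ratr r))).
- exact: mX.
- by apply: mX => //; exact: measurableC.
- move=> z []; rewrite setC_ray /ray/= !in_itv/= !andbT => z1 z2.
  by split=> //; exact: ltW.
- apply: (@fin_num_add_le (p (ray (ratr r) `*` ray (ratr r)))) => //.
    by rewrite fin_num_measure//; exact: mX.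
  by rewrite -measure_setXC// nondecreasing_quadrant// min_l// marginal1E.
Qed.

Lemma nondecreasing_below0 p : nondecreasing_set (msupport p) ->
  (forall x, marginal2 p (ray x) <= marginal1 p (ray x)) -> p below = 0.
Proof.
move=> ndp le12; rewrite belowE.
have mr := @measurable_ray R; have mX := @measurable_rectangle R.
apply: null_countable_bigcup => [r|r _]; first exact: mX.
apply: (@subset_measure0 _ _ _ _ _ (~` ray (ratr r) `*` ray (ratr r))).
- exact: mX.
- by apply: mX => //; exact: measurableC.
- move=> z []; rewrite setC_ray /ray/= !in_itv/= !andbT => z1 z2.
  by split=> //; exact: ltW.
- apply: (@fin_num_add_le (p (ray (ratr r) `*` ray (ratr r)))) => //.
    by rewrite fin_num_measure//; exact: mX.
  by rewrite -measure_setCX// nondecreasing_quadrant// min_r// marginal2E.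
Qed.

Lemma null_above_marginals p : p above = 0 ->
  forall x, marginal1 p (ray x) <= marginal2 p (ray x).
Proof.
move=> p0 x; have mr := @measurable_ray R; have mX := @measurable_rectangle R.
rewrite marginal1E// marginal2E//.
rewrite -[leRHS](measureU0 (mX _ _ measurableT (mr x)) measurable_above p0).
apply: le_measure; rewrite ?inE; first exact: mX.
  by apply: measurableU; [exact: mX|exact: measurable_above].
move=> z [/= z1 _]; have [zle|?] := leP z.2 z.1; last by right.
left; split => //; move: z1; rewrite /ray/= !in_itv/=.
exact: le_trans.
Qed.

Lemma measure_sidesE p A : measurable A ->
  p A = p (A `&` below) + p (A `&` diag) + p (A `&` above).
Proof.
move=> mA; have mb := measurable_below; have ma := measurable_above.
have md := @measurable_diagonal R.
have mI (B : set (R * R)) : measurable B -> measurable (A `&` B).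
  by move=> mB; exact: measurableI.
rewrite (measure_splitI p mA mb) -addeA -(measureU p (mI _ md) (mI _ ma)); last first.
  by rewrite -subset0 => z [[_ eq] [_]]; rewrite /above/= eq ltxx.
congr (_ + p _); rewrite -setIUr; congr (_ `&` _).
apply/seteqP; split => z; rewrite /above/below/diag/=.
  by move/negP; rewrite -leNgt le_eqVlt => /orP[/eqP|]; [left|right].
by move=> [->|/ltW zle]; apply/negP; rewrite -leNgt.
Qed.

Lemma meas_lrE mu A : measurable A -> meas_lr mu A = mu (A `&` below).
Proof. by move=> mA; rewrite bmeasure_restrE. Qed.

Lemma meas_diagE mu A : measurable A -> meas_diag mu A = mu (A `&` diag).
Proof. by move=> mA; rewrite bmeasure_restrE. Qed.

End diagonal_sides.

Section marginal_operations.
Variable R : realType.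
Implicit Types (p q mu nu : meas2 R).

Lemma bmeasure_subK d (T : measurableType d) (D : set T)
    (mu nu : bmeasure R D) : bmeasure_le nu mu ->
  bmeasure_add nu (bmeasure_sub mu nu) = mu.
Proof.
move=> numu; apply: bmeasure_eq => A mA.
by rewrite bmeasure_addE// bmeasure_subE// addeC subeK// fin_num_measure.
Qed.

Lemma bmeasure_addK d (T : measurableType d) (D : set T)
    (mu nu : bmeasure R D) : bmeasure_sub (bmeasure_add mu nu) mu = nu.
Proof.
apply: bmeasure_eq => A mA.
rewrite bmeasure_subE//; last by move=> B mB; rewrite bmeasure_addE// leeDl.
by rewrite bmeasure_addE// addeAC subee ?add0e// fin_num_measure.
Qed.

Lemma marginal1D p q :
  marginal1 (bmeasure_add p q) = bmeasure_add (marginal1 p) (marginal1 q).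
Proof.
apply: bmeasure_eq => A mA.
rewrite marginal1E// !bmeasure_addE// ?marginal1E//.
exact: measurable_rectangle.
Qed.

Lemma marginal2D p q :
  marginal2 (bmeasure_add p q) = bmeasure_add (marginal2 p) (marginal2 q).
Proof.
apply: bmeasure_eq => A mA.
rewrite marginal2E// !bmeasure_addE// ?marginal2E//.
exact: measurable_rectangle.
Qed.

Lemma marginal_setT p : marginal1 p setT = marginal2 p setT.
Proof. by rewrite marginal1E// marginal2E. Qed.

Lemma marginal1_le p q : bmeasure_le p q ->
  bmeasure_le (marginal1 p) (marginal1 q).
Proof.
by move=> pq A mA; rewrite !marginal1E//; apply: pq; exact: measurable_rectangle.
Qed.

Lemma marginal2_le p q : bmeasure_le p q ->
  bmeasure_le (marginal2 p) (marginal2 q).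
Proof.
by move=> pq A mA; rewrite !marginal2E//; apply: pq; exact: measurable_rectangle.
Qed.

End marginal_operations.

Section Psi_fibres.
Variable R : realType.
Implicit Types (mu nu : meas2 R) (p : meas1 R * meas1 R).

Lemma meas1_rayE (m : meas1 R) x : m (ray x) = m `[0%R, x]%classic.
Proof.
have mI := @measurable_unit_interval R.
rewrite -(bmeasure_setI m mI (measurable_ray x)).
rewrite -[RHS](bmeasure_setI m mI (measurable_itv _)).
congr (m _); apply/seteqP; split => z []; rewrite /ray/unit_interval/= !in_itv/=.
  by move=> -> /andP[-> ->].
by move=> /andP[_ ->] /andP[-> ->].
Qed.

(** The same domain described with rays of the whole line, which spares the case
    distinction on x in [0, 1] afterwards. *)
Lemma DsetP p : Dset p <->
  [/\ bmeasure_le p.1 (leb R), bmeasure_le p.2 (leb R), p.1 setT = p.2 setT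
    & forall x, p.1 (ray x) <= p.2 (ray x)].
Proof.
rewrite !meas1_setT; split=> -[p1 p2 pT pxs]; split => // x; last by rewrite -!meas1_rayE.
have [x0|x0] := ltP x 0%R; first by rewrite !meas1_ray_lt0.
have [x1|x1] := leP x 1%R; last by rewrite !meas1_ray_ge1 ?meas1_setT ?pT// ltW.
by rewrite !meas1_rayE; apply: pxs; rewrite /unit_interval/= in_itv/= x0.
Qed.

Lemma leb_setT : leb R setT = 1.
Proof.
by rewrite lebE// setTI /unit_interval lebesgue_measure_itv/= lte_fin ltr01 oppr0 adde0.
Qed.

(** What the two summands of Psi p are used for: they are monotone couplings, and
    the order on the distribution functions of p.1 and p.2 (reversed by taking
    complements in leb) keeps them on opposite sides of the diagonal. *)
Lemma PsiP p : Dset p ->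
  exists P Q : meas2 R,
  [/\ Psi p = bmeasure_add P Q,
     marginal1 P = p.1 /\ marginal2 P = p.2,
     marginal1 Q = bmeasure_sub (leb R) p.1 /\
       marginal2 Q = bmeasure_sub (leb R) p.2,
     nondecreasing_set (msupport P) /\ nondecreasing_set (msupport Q) &
     P (@above R) = 0 /\ Q (@below R) = 0].
Proof.
move=> /DsetP[p1 p2 pT pxs].
exists (nearrow p.1 p.2), (nearrow (bmeasure_sub (leb R) p.1) (bmeasure_sub (leb R) p.2)).
have [P1 P2 ndP] := nearrowP pT.
have qT : bmeasure_sub (leb R) p.1 setT = bmeasure_sub (leb R) p.2 setT.
  by rewrite !bmeasure_subE// pT.
have [Q1 Q2 ndQ] := nearrowP qT.
split => //.
split.
  by apply: nondecreasing_above0 => // x; rewrite P1 P2.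
apply: nondecreasing_below0 => // x; rewrite Q1 Q2.
by rewrite !bmeasure_subE//; try exact: measurable_ray; rewrite leeB.
Qed.

(** The supports of the two summands are nondecreasing and carry Psi p. *)
Lemma Psi_permuton321 p : Dset p -> permuton321 (Psi p).
Proof.
move=> Dp; have [lp1 lp2 _ _] := (DsetP p).1 Dp.
have [P [Q [-> [P1 P2] [Q1 Q2] [ndP ndQ] _]]] := PsiP Dp.
have m1 : marginal1 (bmeasure_add P Q) = leb R.
  by rewrite marginal1D P1 Q1 bmeasure_subK.
have m2 : marginal2 (bmeasure_add P Q) = leb R.
  by rewrite marginal2D P2 Q2 bmeasure_subK.
split.
  split => //.
  rewrite -leb_setT -m1 marginal1E// setXTT.
  by rewrite -[RHS](bmeasure_setI _ (@measurable_unit_square R))// setTI.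
apply: (@nondecreasing_cover_avoids321 _ _ (msupport P) (msupport Q)) => //.
- exact: measurable_msupport.
- exact: measurable_msupport.
- have mP := measurable_msupport P; have mQ := measurable_msupport Q.
  rewrite bmeasure_addE; last by apply/measurableC/measurableU.
  rewrite setCU [X in X + _](_ : _ = 0) ?[X in _ + X](_ : _ = 0) ?adde0//.
    apply: (subset_measure0 _ _ _ (null_compl_msupport Q)); last by move=> z [].
      by apply: measurableI; exact: measurableC.
    exact: measurableC.
  apply: (subset_measure0 _ _ _ (null_compl_msupport P)); last by move=> z [].
    by apply: measurableI; exact: measurableC.
  exact: measurableC.
Qed.

(** Both p = meas_lr mu + nu and mu - p have their supports inside that of mu, on
    one closed side of the diagonal each, hence nondecreasing: they are the
    monotone couplings of their own marginals. *)
Lemma Psi_lr_diag mu nu : permuton321 mu -> bmeasure_le nu (meas_diag mu) ->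
  Dset (marginals (bmeasure_add (meas_lr mu) nu)) /\
  Psi (marginals (bmeasure_add (meas_lr mu) nu)) = mu.
Proof.
move=> mu321 nud; set p := bmeasure_add _ nu.
have [[_ mu1 mu2] _] := mu321.
have mb := @measurable_below R; have ma := @measurable_above R.
have md := @measurable_diagonal R.
have pmu : bmeasure_le p mu.
  move=> A mA; rewrite bmeasure_addE// meas_lrE// (measure_sidesE mu mA).
  rewrite (le_trans _ (leeDl _ (measure_ge0 mu _)))//.
  by rewrite leeD2l// -meas_diagE// nud.
have pa : p (@above R) = 0.
  rewrite bmeasure_addE// meas_lrE// (_ : @above R `&` _ = set0); last first.
    rewrite -subset0 => z [/= ab ba]; have := lt_trans ba ab.
    by rewrite ltxx.
  rewrite measure0 add0e; apply/eqP; rewrite eq_le measure_ge0 andbT.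
  rewrite (le_trans (nud _ ma))// meas_diagE// (_ : _ `&` _ = set0) ?measure0//.
  by rewrite -subset0 => z [ab /= eq]; move: ab; rewrite /above/= eq ltxx.
pose q := bmeasure_sub mu p.
have qmu : bmeasure_le q mu.
  by move=> A mA; rewrite bmeasure_subE// leeBlDr ?fin_num_measure// leeDl.
have qb : q (@below R) = 0.
  rewrite bmeasure_subE// bmeasure_addE// meas_lrE// setIid.
  rewrite (_ : nu (@below R) = 0) ?adde0 ?subee ?fin_num_measure//.
  apply/eqP; rewrite eq_le measure_ge0 andbT.
  rewrite (le_trans (nud _ mb))// meas_diagE// (_ : _ `&` _ = set0) ?measure0//.
  by rewrite -subset0 => z [ba /= eq]; move: ba; rewrite /below/= eq ltxx.
have ndp : nondecreasing_set (msupport p).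
  have := permuton321_below mu321 => nd z w Sz Sw; apply: nd; split;
    (try exact: sub_msupport pmu _ _); rewrite /= leNgt; apply/negP.
    exact: msupport_open_null (@open_above R) pa _ Sz.
  exact: msupport_open_null (@open_above R) pa _ Sw.
have ndq : nondecreasing_set (msupport q).
  have := permuton321_above mu321 => nd z w Sz Sw; apply: nd; split;
    (try exact: sub_msupport qmu _ _); rewrite /= leNgt; apply/negP.
    exact: msupport_open_null (@open_below R) qb _ Sz.
  exact: msupport_open_null (@open_below R) qb _ Sw.
have pq : bmeasure_add p q = mu by exact: bmeasure_subK.
split.
  apply/DsetP; split.
  - by rewrite -mu1; exact: marginal1_le.
  - by rewrite -mu2; exact: marginal2_le.
  - exact: marginal_setT.
  - exact: null_above_marginals.
have q1 : bmeasure_sub (leb R) (marginal1 p) = marginal1 q.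
  by rewrite -mu1 -pq marginal1D bmeasure_addK.
have q2 : bmeasure_sub (leb R) (marginal2 p) = marginal2 q.
  by rewrite -mu2 -pq marginal2D bmeasure_addK.
transitivity (bmeasure_add (nearrow (marginal1 p) (marginal2 p))
    (nearrow (bmeasure_sub (leb R) (marginal1 p))
             (bmeasure_sub (leb R) (marginal2 p)))); first by [].
by rewrite q1 q2 !nearrow_marginals.
Qed.

(** The first summand of Psi p agrees with Psi p below the diagonal, because the
    second one vanishes there, and has no mass above it; its diagonal part is the
    required nu. *)
Lemma Psi_inverse p mu : Dset p -> Psi p = mu ->
  exists2 nu, bmeasure_le nu (meas_diag mu)
            & marginals (bmeasure_add (meas_lr mu) nu) = p.
Proof.
move=> Dp <-; have [P [Q [-> [P1 P2] _ _ [Pa Qb]]]] := PsiP Dp.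
have Pp : marginals P = p by rewrite /marginals P1 P2; case: (p).
have mb := @measurable_below R; have ma := @measurable_above R.
have md := @measurable_diagonal R.
exists (meas_diag P).
  move=> A mA; rewrite !meas_diagE// bmeasure_addE ?leeDl//.
  exact: measurableI.
rewrite -Pp; congr marginals; apply: bmeasure_eq => A mA.
have mI (B : set (R * R)) : measurable B -> measurable (A `&` B).
  by move=> mB; exact: measurableI.
rewrite bmeasure_addE// meas_lrE// meas_diagE// bmeasure_addE; last exact: mI.
rewrite (_ : Q _ = 0); last first.
  by apply: subset_measure0 Qb => //; exact: mI.
rewrite (measure_sidesE P mA) adde0 (_ : P (A `&` @above R) = 0) ?adde0//.
by apply: subset_measure0 Pa => //; exact: mI.
Qed.

End Psi_fibres.

Local Close Scope ereal_scope.

(** * Weak convergence and Riemann sums *)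

Section weak_topology.
Variable R : realType.

Lemma cvg_initial (S : choiceType) (T : topologicalType) (f : S -> T)
    (F : set_system S) (s : S) : Filter F ->
  f @ F --> f s -> F --> (s : initial_topology f).
Proof.
move=> FF fFs A; rewrite nbhsE => -[_ [[B oB <-] Bs] BA].
by apply: filterS BA _; apply: fFs; exact: open_nbhs_nbhs.
Qed.

Lemma cvg_prod_topology (I : Type) (F : set_system (prod_topology (fun _ : I => R)))
    (s : prod_topology (fun _ : I => R)) : Filter F ->
  (forall i, (fun f => f i) @ F --> s i) -> F --> s.
Proof.
by move=> FF Fs; apply/cvg_sup => i; apply: cvg_initial; exact: Fs.
Qed.

Lemma proj_prod_topology_continuous (I : Type) (i : I) :
  continuous ((fun f => f i) : prod_topology (fun _ : I => R) -> R).
Proof.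
move=> s; have /cvg_sup/(_ i) si : nbhs s --> s by exact: cvg_id.
apply: cvg_trans; last first.
  exact: (@initial_continuous _ _ (fun f : forall i : I, R => f i) s).
exact: cvg_app si.
Qed.

Lemma weak_eval1_continuous (f : R -> R) :
  {within @unit_interval R, continuous f} ->
  continuous (fun mu : meas1 R => \int[mu]_(x in @unit_interval R) f x).
Proof.
move=> cf mu.
pose t : @test1 R := exist _ f (mem_set cf).
have : continuous (@weak_eval1 R : meas1 R -> _) by exact: initial_continuous.
move=> /(_ mu) => c1.
exact: (cvg_comp _ _ c1 (@proj_prod_topology_continuous _ t _)).
Qed.

Lemma cvg_meas2 (T : Type) (F : set_system T) (m : T -> meas2 R) (mu : meas2 R) :
  Filter F ->
  (forall f, {within @unit_square R, continuous f} ->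
    \int[m t]_(z in @unit_square R) f z @[t --> F] -->
    \int[mu]_(z in @unit_square R) f z) ->
  m @ F --> mu.
Proof.
move=> FF H; apply: cvg_initial; apply: cvg_prod_topology => -[f cf].
exact: (H f (set_mem cf)).
Qed.

(** A uniform limit of functions that converge along F converges along F, in a form
    that allows the approximation to hold only eventually. *)
Lemma cvg_near_approx (T : Type) (F : set_system T) (g : T -> R) (l : R) :
  Filter F ->
  (forall e : R, 0 < e -> exists s : T -> R, exists sl : R,
    [/\ s @ F --> sl, `|l - sl| <= e & \forall t \near F, `|g t - s t| <= e]) ->
  g @ F --> l.
Proof.
move=> FF H; apply/cvgrPdist_le => e e0.
have e3 : 0 < e / 3 by rewrite divr_gt0.
have [s [sl [/cvgrPdist_le ssl lsl gs]]] := H (e / 3) e3.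
near=> t.
have h1 : `|sl - s t| <= e / 3 by near: t; exact: ssl.
have h2 : `|g t - s t| <= e / 3 by near: t.
have -> : l - g t = (l - sl) + (sl - s t) - (g t - s t) by ring.
rewrite (le_trans (ler_normB _ _))//.
by have := ler_normD (l - sl) (sl - s t); lra.
Unshelve. all: by end_near. Qed.

End weak_topology.

Section integrals.
Variable R : realType.

Lemma Rintegral_indic d (T : measurableType d) (mu : {measure set T -> \bar R})
    (D A : set T) : measurable D -> measurable A ->
  \int[mu]_(x in D) \1_A x = fine (mu (A `&` D)).
Proof. by move=> mD mA; rewrite /Rintegral integral_indic. Qed.

Lemma within_continuous_measurable2 (D : set (R * R)) (f : R * R -> R) :
  measurable D -> {within D, continuous f} -> measurable_fun D f.
Proof.
move=> mD /continuousP cf; apply: (measurability _ (RGenOpens.measurableE R)).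
move=> _ [_ [a [b ->] <-]].
have /cf/open_subspaceP[V oV VD] : open `]a, b[%classic by exact: interval_open.
by rewrite setIC -VD; apply: measurableI => //; exact: open2_measurable.
Qed.

Lemma compact_unit_square : compact (@unit_square R).
Proof. by apply: compact_setX; exact: segment_compact. Qed.

Lemma integrable_unit_square (mu : {finite_measure set (R * R)%type -> \bar R})
    (f : R * R -> R) : {within @unit_square R, continuous f} ->
  mu.-integrable (@unit_square R) (EFin \o f).
Proof.
move=> cf; have mS := @measurable_unit_square R.
apply: measurable_bounded_integrable => //.
- by rewrite -ge0_fin_numE// fin_num_measure.
- exact: within_continuous_measurable2.
- have /(@compact_bounded _ R^o)[M [_ mrt]] :=
    continuous_compact cf compact_unit_square.
  by exists M; split; rewrite ?num_real // => ? ? ? ?; exact: mrt.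
Qed.

Lemma unit_square_unif_continuous (f : R * R -> R) (e : R) :
  {within @unit_square R, continuous f} -> 0 < e ->
  exists2 delta : R, 0 < delta & forall z w, @unit_square R z -> @unit_square R w ->
    `|z.1 - w.1| < delta -> `|z.2 - w.2| < delta -> `|f z - f w| <= e.
Proof.
move=> /subspace_continuousP cf e0.
have /compact_near_coveringP/near_covering_withinP := compact_unit_square.
pose P (delta : R) (z : R * R) := forall w, @unit_square R w ->
    `|z.1 - w.1| < delta -> `|z.2 - w.2| < delta -> `|f z - f w| <= e.
move=> /(_ R (0^'+) P _) [].
  move=> x Kx; have /cvgrPdist_le/(_ (e / 2)) := cf x Kx.
  rewrite divr_gt0// => /(_ isT).
  rewrite near_withinE => /nbhs_ballP[eta /= eta0 xe].
  exists (ball x (eta / 2), [set delta | 0 < delta < eta / 2]).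
    split; first by apply: nbhsx_ballx; rewrite divr_gt0.
    near=> delta; apply/andP; split; near: delta; first exact: nbhs_right_gt.
    by apply: nbhs_right_lt; rewrite divr_gt0.
  move=> [z delta] /= [[xz1 xz2] /andP[d0 deta]] Kz w Kw zw1 zw2.
  have xw : ball x eta w.
    split; rewrite /ball/=.
      rewrite (_ : x.1 - w.1 = (x.1 - z.1) + (z.1 - w.1)); last by ring.
      rewrite (le_lt_trans (ler_normD _ _))//.
      by move: xz1; rewrite /ball/=; lra.
    rewrite (_ : x.2 - w.2 = (x.2 - z.2) + (z.2 - w.2)); last by ring.
    rewrite (le_lt_trans (ler_normD _ _))//.
    by move: xz2; rewrite /ball/=; lra.
  have xz : ball x eta z.
    by split; [apply: le_ball xz1|apply: le_ball xz2]; lra.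
  rewrite (_ : f z - f w = (f x - f w) - (f x - f z)); last by ring.
  rewrite (le_trans (ler_normB _ _))//.
  by have := xe _ xw Kw; have := xe _ xz Kz; lra.
move=> delta /= d0 H; exists (delta / 2); first by rewrite divr_gt0.
move=> z w Kz; apply: (H (delta / 2)) => //=; last by rewrite divr_gt0.
rewrite sub0r normrN gtr0_norm ?divr_gt0//.
by rewrite ltr_pdivrMr// ltr_pMr// ltr1n.
Unshelve. all: by end_near. Qed.

(** Comparison of f with the step function equal to c k on B k. *)
Lemma Rintegral_approx d (T : measurableType d)
    (mu : {finite_measure set T -> \bar R}) (D : set T) (K : finType)
    (B : K -> set T) (c : K -> R) (f : T -> R) (e : R) :
  measurable D -> (forall k, measurable (B k)) -> trivIset setT B ->
  mu.-integrable D (EFin \o f) ->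
  (forall z, D z -> exists2 k, B k z & `|f z - c k| <= e) ->
  `|\int[mu]_(z in D) f z - \sum_k c k * fine (mu (B k `&` D))|
    <= e * fine (mu D).
Proof.
move=> mD mB tB intf fc.
have Bk z k : B k z -> \sum_l c l * \1_(B l) z = c k.
  move=> Bkz; rewrite (bigD1 k)//= indicE mem_set// mulr1 big1 ?addr0// => l lk.
  rewrite indicE memNset ?mulr0// => Blz; move/eqP: lk; apply.
  by apply: (tB l k) => //; exists z.
pose s z := \sum_k c k * \1_(B k) z.
have inti k : mu.-integrable D (fun z => ((c k)%:E * (\1_(B k) z)%:E)%E).
  apply: integrableZl => //; apply: integrableS (integrable_indic mu (mB k)) => //.
have sE : EFin \o s = (fun z => \sum_k ((c k)%:E * (\1_(B k) z)%:E)%E).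
  by apply/funext => z; rewrite /s/= -sumEFin.
have ints : mu.-integrable D (EFin \o s).
  by rewrite sE; apply: integrable_sum.
have <- : \int[mu]_(z in D) s z = \sum_k c k * fine (mu (B k `&` D)).
  rewrite /Rintegral.
  rewrite (_ : (fun z => (s z)%:E) = EFin \o s)// sE integral_sum//.
  rewrite -sum_fine; last first.
    move=> k _; exact: integrable_fin_num.
  apply: eq_bigr => k _; rewrite integralZl//; last first.
    by apply: integrableS (integrable_indic mu (mB k)).
  rewrite integral_indic// fineM// fin_num_measure//.
  exact: measurableI.
rewrite -RintegralB//.
have intd : mu.-integrable D (EFin \o (fun z => f z - s z)).
  rewrite (_ : EFin \o _ = (EFin \o f) \- (EFin \o s))%E//.
  exact: integrableB.
rewrite (le_trans (le_normr_Rintegral _ _))// -Rintegral_cst//.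
apply: le_Rintegral => //.
- exact: integrable_norm.
- apply: measurable_bounded_integrable => //.
    by rewrite -ge0_fin_numE// fin_num_measure.
  exact: bounded_cst.
by move=> z /fc[k Bkz]; rewrite /s (Bk _ _ Bkz).
Qed.

End integrals.

(** * Continuity of Psi *)

Section cdf_continuity.
Variable R : realType.
Implicit Types (mu : meas1 R) (x y : R).

Lemma integrable_unit_interval mu (f : R -> R) :
  {within @unit_interval R, continuous f} ->
  mu.-integrable (@unit_interval R) (EFin \o f).
Proof.
move=> cf; have mI := @measurable_unit_interval R.
apply: measurable_bounded_integrable => //.
- by rewrite -ge0_fin_numE// fin_num_measure.
- exact: subspace_continuous_measurable_fun.
- have /(@compact_bounded _ R^o)[M [_ mrt]] :=
    continuous_compact cf (@segment_compact _ _ _).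
  by exists M; split; rewrite ?num_real // => ? ? ? ?; exact: mrt.
Qed.

Lemma mcdf_Lipschitz mu x (e : R) : bmeasure_le mu (leb R) -> 0 <= e ->
  mcdf mu (x + e) <= mcdf mu x + e.
Proof.
move=> mule e0; rewrite -lee_fin EFinD !mcdfE.
have xe : x <= x + e by rewrite lerDl.
rewrite (ray_split xe).
have mr := measurable_ray x.
rewrite (le_trans (measureU2 _ mr (measurable_itv _)))// leeD2l//.
rewrite (le_trans (mule _ (measurable_itv _)))// lebE; last exact: measurable_itv.
apply: (@le_trans _ _ (lebesgue_measure `]x, (x + e)%R]%classic)).
  apply: le_measure; rewrite ?inE//; try exact: measurable_itv.
  by apply: measurableI; [exact: measurable_itv|exact: measurable_unit_interval].
rewrite lebesgue_measure_itv/= lte_fin; case: ifPn => _; last by rewrite lee_fin.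
by rewrite -EFinD lee_fin addrAC subrr add0r.
Qed.

(** A continuous substitute for the indicator of ray x: it decreases linearly from
    1 to 0 between x and x + e. *)
Definition ramp x (e : R) : R -> R :=
  (cst 1%R : R -> R^o) \min ((cst 0%R : R -> R^o) \max (fun z => 1 - (z - x) / e)).

Lemma continuous_ramp x e : continuous (ramp x e).
Proof.
move=> z; apply: continuous_min; first exact: cst_continuous.
apply: continuous_max; first exact: cst_continuous.
apply: cvgB; first exact: cvg_cst.
by apply: cvgMl; apply: cvgB; [exact: cvg_id|exact: cvg_cst].
Qed.

(** The ramp lies between the indicators of ray x and ray (x + e), whose integrals
    differ by at most e for a measure dominated by Lebesgue measure. *)
Lemma mcdf_ramp mu x (e : R) : bmeasure_le mu (leb R) -> 0 < e ->
  `|mcdf mu x - \int[mu]_(z in @unit_interval R) ramp x e z| <= e.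
Proof.
move=> mule e0; have mI := @measurable_unit_interval R.
have mr := @measurable_ray R.
have intr := integrable_unit_interval mu (continuous_subspaceT (@continuous_ramp x e)).
have inti y : mu.-integrable (@unit_interval R) (EFin \o \1_(ray y)).
  by apply: integrableS (integrable_indic mu (mr y)).
have cdfE y : mcdf mu y = \int[mu]_(z in @unit_interval R) \1_(ray y) z.
  by rewrite Rintegral_indic//; congr fine; exact: (esym (bmeasure_setI mu mI (mr y))).
have lo : mcdf mu x <= \int[mu]_(z in @unit_interval R) ramp x e z.
  rewrite cdfE; apply: le_Rintegral => // z _; rewrite indicE /ramp/=.
  have [zx|_] := boolP (z \in ray x); last by rewrite le_min ler01 le_max lexx.
  rewrite le_min lexx le_max; apply/orP; right.
  move: zx; rewrite inE /ray/= in_itv/= => zx.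
  by rewrite lerDl oppr_ge0 pmulr_lle0 ?invr_gt0// subr_le0.
have hi : \int[mu]_(z in @unit_interval R) ramp x e z <= mcdf mu (x + e).
  rewrite cdfE; apply: le_Rintegral => // z _; rewrite indicE /ramp/=.
  have [_|] := boolP (z \in ray (x + e)); first by rewrite ge_min lexx.
  rewrite notin_setE /ray/= in_itv/= => /negP; rewrite -ltNge => xz.
  rewrite ge_min; apply/orP; right; rewrite ge_max lexx/=.
  by rewrite subr_le0 ler_pdivlMr// mul1r; lra.
have := mcdf_Lipschitz x mule (ltW e0).
by rewrite ler_norml; lra.
Qed.

(** The domination by leb makes the ramp approximation uniform in the measure, and
    integrals of ramps are weakly continuous. *)
Lemma cvg_mcdf (T : Type) (F : set_system T) (m : T -> meas1 R) mu x :
  Filter F -> m @ F --> mu -> bmeasure_le mu (leb R) ->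
  (\forall t \near F, bmeasure_le (m t) (leb R)) ->
  mcdf (m t) x @[t --> F] --> mcdf mu x.
Proof.
move=> FF mmu mule mle; apply: cvg_near_approx => e e0.
pose s (n : meas1 R) := \int[n]_(z in @unit_interval R) ramp x e z.
exists (s \o m), (s mu); split; last 2 first.
- exact: mcdf_ramp.
- by near=> t; apply: mcdf_ramp => //; near: t.
apply: (cvg_comp _ _ mmu).
exact: weak_eval1_continuous (continuous_subspaceT (@continuous_ramp x e)) mu.
Unshelve. all: by end_near. Qed.

End cdf_continuity.

Section limits.
Variable R : realType.
Context (T : Type) (F : set_system T) {FF : Filter F}.

Lemma cvg_minr (f g : T -> R) (a b : R) : f @ F --> a -> g @ F --> b ->
  Num.min (f t) (g t) @[t --> F] --> Num.min a b.
Proof.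
move=> fa gb; rewrite minr_absE.
under eq_fun do rewrite minr_absE.
apply: cvgMl; apply: cvgB; first exact: cvgD.
by apply: cvg_norm; exact: cvgB.
Qed.

Lemma cvg_finsum (K : finType) (f : K -> T -> R) (a : K -> R) :
  (forall k, f k @ F --> a k) -> \sum_k f k t @[t --> F] --> \sum_k a k.
Proof.
move=> fa; elim: (index_enum K) => [|k s IHs].
  rewrite big_nil; under eq_fun do rewrite big_nil; exact: cvg_cst.
by rewrite big_cons; under eq_fun do rewrite big_cons; exact: cvgD.
Qed.

End limits.

Section grid.
Variables (R : realType) (n : nat).

Definition grid_point (i : nat) : R := i%:R / n.+1%:R.
(** For i = 0 the left end is negative, so that the cells are half-open and still
    cover 0. *)
Definition grid_left (i : nat) : R := (i%:R - 1) / n.+1%:R.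
Definition grid_cell (i : nat) : set R := `]grid_left i, grid_point i]%classic.

Let index := ('I_n.+2 * 'I_n.+2)%type.
Definition grid_box (k : index) : set (R * R) := grid_cell k.1 `*` grid_cell k.2.

Lemma grid_left_le i : grid_left i <= grid_point i.
Proof. by rewrite ler_pM2r ?invr_gt0 ?ltr0n// gerBl. Qed.

Lemma grid_cellP i z : grid_cell i z <-> i%:R - 1 < z * n.+1%:R <= i%:R.
Proof.
by rewrite /grid_cell/= in_itv/= ltr_pdivrMr ?ltr0n// ler_pdivlMr ?ltr0n.
Qed.

Lemma grid_cell_inj i j z : grid_cell i z -> grid_cell j z -> i = j.
Proof.
move=> /grid_cellP/andP[i1 i2] /grid_cellP/andP[j1 j2].
have ij : (i < j.+1)%N by rewrite -(ltr_nat R) -natr1; lra.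
have ji : (j < i.+1)%N by rewrite -(ltr_nat R) -natr1; lra.
by apply/eqP; rewrite eqn_leq -ltnS ij -ltnS.
Qed.

Lemma grid_cover z : unit_interval z -> exists i : 'I_n.+2, grid_cell i z.
Proof.
rewrite /unit_interval/= in_itv/= => /andP[z0 z1].
have ex : exists i : nat, z * n.+1%:R <= i%:R.
  by exists n.+1; rewrite ler_piMl.
case: (ex_minnP ex) => i zi imin.
have iN : (i < n.+2)%N by rewrite ltnS; apply: imin; rewrite ler_piMl.
exists (Ordinal iN); apply/grid_cellP; rewrite zi andbT/=.
case: i zi imin iN => [_ _ _|i zi imin _].
  by rewrite sub0r (lt_le_trans (ltrN10 _))// mulr_ge0.
rewrite -natr1 addrK ltNge; apply/negP => /imin.
by rewrite ltnn.
Qed.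

Lemma grid_box_disjoint : trivIset setT grid_box.
Proof.
move=> [i j] [i' j'] _ _ [z [[/= zi zj] [/= zi' zj']]].
by congr pair; apply: val_inj; [exact: grid_cell_inj zi zi'|exact: grid_cell_inj zj zj'].
Qed.

Lemma grid_point_unit (i : 'I_n.+2) : unit_interval (grid_point i).
Proof.
rewrite /unit_interval/= in_itv/= divr_ge0//= ler_pdivrMr ?ltr0n// mul1r.
by rewrite ler_nat -ltnS.
Qed.

Lemma grid_cell_dist i z : grid_cell i z -> `|z - grid_point i| < n.+1%:R^-1.
Proof.
rewrite /grid_cell/= in_itv/= /grid_left mulrBl div1r -/(grid_point i).
set d := n.+1%:R^-1; have d0 : 0 < d by rewrite invr_gt0 ltr0n.
by move=> /andP[z1 z2]; rewrite ltr_norml; apply/andP; split; lra.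
Qed.

Lemma measurable_grid_box k : measurable (grid_box k).
Proof. by apply: measurableX; exact: measurable_itv. Qed.

End grid.

Section quadrants.
Variable R : realType.
Implicit Types (mu : meas2 R) (p : meas1 R * meas1 R).

Definition quadrant mu (x y : R) : R := fine (mu (ray x `*` ray y)).

Lemma fine_rectangle1 mu (a b : R) (C : set R) : a <= b -> measurable C ->
  fine (mu (`]a, b]%classic `*` C)) = fine (mu (ray b `*` C)) - fine (mu (ray a `*` C)).
Proof.
move=> ab mC; have mX := @measurable_rectangle R.
have mab : measurable `]a, b]%classic by exact: measurable_itv.
have ma := measurable_ray a.
have -> : ray b `*` C = (ray a `*` C) `|` (`]a, b]%classic `*` C).
  rewrite (ray_split ab); apply/seteqP; split => [z [[? ?|? ?]]|z [] [? ?]].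
  - by left.
  - by right.
  - by split => //; left.
  - by split => //; right.
rewrite measureU; [|exact: mX|exact: mX|].
  by rewrite fineD ?fin_num_measure//; [rewrite addrAC subrr add0r|exact: mX|exact: mX].
by rewrite -setXI ray_split0 set0X.
Qed.

Lemma fine_rectangle2 mu (a b : R) (C : set R) : a <= b -> measurable C ->
  fine (mu (C `*` `]a, b]%classic)) = fine (mu (C `*` ray b)) - fine (mu (C `*` ray a)).
Proof.
move=> ab mC; have mX := @measurable_rectangle R.
have mab : measurable `]a, b]%classic by exact: measurable_itv.
have ma := measurable_ray a.
have -> : C `*` ray b = (C `*` ray a) `|` (C `*` `]a, b]%classic).
  rewrite (ray_split ab); apply/seteqP; split => [z [? [?|?]]|z [] [? ?]].
  - by left.
  - by right.
  - by split => //; left.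
  - by split => //; right.
rewrite measureU; [|exact: mX|exact: mX|].
  by rewrite fineD ?fin_num_measure//; [rewrite addrAC subrr add0r|exact: mX|exact: mX].
by rewrite -setXI ray_split0 setX0.
Qed.

(** Inclusion-exclusion over the four corners. *)
Lemma fine_rectangle mu (a b c d : R) : a <= b -> c <= d ->
  fine (mu (`]a, b]%classic `*` `]c, d]%classic)) =
  quadrant mu b d - quadrant mu a d - (quadrant mu b c - quadrant mu a c).
Proof.
move=> ab cd; have mr := @measurable_ray R.
rewrite (@fine_rectangle2 mu c d _ cd (measurable_itv _)).
by rewrite !(@fine_rectangle1 mu a b)//; exact: mr.
Qed.

Lemma fine_mine (x y : \bar R) : x \is a fin_num -> y \is a fin_num ->
  fine (mine x y) = Num.min (fine x) (fine y).
Proof. by case: x y => [x||] [y||]// _ _; rewrite -EFin_min. Qed.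

Lemma Psi_quadrant p x y : Dset p -> quadrant (Psi p) x y =
  Num.min (mcdf p.1 x) (mcdf p.2 y) +
  Num.min (mcdf (leb R) x - mcdf p.1 x) (mcdf (leb R) y - mcdf p.2 y).
Proof.
move=> Dp; have [lp1 lp2 _ _] := (DsetP p).1 Dp.
have [P [Q [-> [P1 P2] [Q1 Q2] [ndP ndQ] _]]] := PsiP Dp.
have mr := @measurable_ray R.
have mX : measurable (ray x `*` ray y) by exact: measurable_rectangle.
rewrite /quadrant bmeasure_addE// fineD ?fin_num_measure//.
rewrite !nondecreasing_quadrant// P1 P2 Q1 Q2 !bmeasure_subE//.
rewrite !fine_mine ?fin_numB ?fin_num_measure//.
by rewrite !fineB ?fin_num_measure.
Qed.

End quadrants.

(** On the grid the integral of f is within e of a combination of masses of boxes,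
    with the same grid for the whole domain since every Psi p has mass 1. *)
Lemma Psi_continuous (R : realType) : {within @Dset R, continuous (@Psi R)}.
Proof.
apply/subspace_continuousP => p0 Dp0.
set F := within _ _.
have FF : Filter F by apply: within_filter; exact: nbhs_filter.
have FD : \forall p \near F, Dset p by exact: withinT.
have [lp1 lp2 _ _] := (DsetP p0).1 Dp0.
have cdf1 x : mcdf p.1 x @[p --> F] --> mcdf p0.1 x.
  apply: cvg_mcdf => //; first by apply: cvg_within_filter; exact: cvg_fst.
  by apply: filterS FD => p /DsetP[].
have cdf2 x : mcdf p.2 x @[p --> F] --> mcdf p0.2 x.
  apply: cvg_mcdf => //; first by apply: cvg_within_filter; exact: cvg_snd.
  by apply: filterS FD => p /DsetP[].
have cquad x y : quadrant (Psi p) x y @[p --> F] --> quadrant (Psi p0) x y.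
  rewrite Psi_quadrant//.
  apply: (@cvg_trans _ ((fun p => Num.min (mcdf p.1 x) (mcdf p.2 y) +
    Num.min (mcdf (leb R) x - mcdf p.1 x) (mcdf (leb R) y - mcdf p.2 y)) @ F)).
    by apply: near_eq_cvg; apply: filterS FD => p Dp; rewrite Psi_quadrant.
  apply: cvgD; first exact: cvg_minr.
  by apply: cvg_minr; apply: cvgB => //; exact: cvg_cst.
apply: cvg_meas2 => f cf; apply: cvg_near_approx => e e0.
have [delta delta0 fdelta] := unit_square_unif_continuous cf e0.
have delta1 : 0 <= delta^-1 by rewrite invr_ge0 ltW.
pose n := Num.truncn delta^-1.
have ndelta : n.+1%:R^-1 < delta.
  rewrite -[ltRHS]invrK ltf_pV2 ?posrE ?invr_gt0 ?ltr0n//.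
  by have /andP[] := Num.Theory.truncn_itv delta1.
pose S (mu : meas2 R) := \sum_(k : 'I_n.+2 * 'I_n.+2)
  f (grid_point R n k.1, grid_point R n k.2) * fine (mu (@grid_box R n k `&` @unit_square R)).
have approx p : Dset p -> `|\int[Psi p]_(z in @unit_square R) f z - S (Psi p)| <= e.
  move=> /Psi_permuton321[[mass _ _] _].
  rewrite -[leRHS]mulr1 -[X in _ * X]/(fine 1%:E) -mass.
  apply: Rintegral_approx.
  - exact: measurable_unit_square.
  - exact: measurable_grid_box.
  - exact: grid_box_disjoint.
  - exact: integrable_unit_square.
  - move=> z [z1 z2].
    have [i zi] := grid_cover n z1; have [j zj] := grid_cover n z2.
    exists (i, j) => //=; apply: fdelta => //.
    + by split; exact: grid_point_unit.
    + exact: lt_trans (grid_cell_dist zi) ndelta.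
    + exact: lt_trans (grid_cell_dist zj) ndelta.
exists (S \o @Psi R), (S (Psi p0)); split; last 2 first.
- exact: approx.
- by apply: filterS FD => p; exact: approx.
apply: cvg_finsum => k; apply: cvgMr.
have boxE (mu : meas2 R) : fine (mu (@grid_box R n k `&` @unit_square R)) =
    quadrant mu (grid_point R n k.1) (grid_point R n k.2)
  - quadrant mu (grid_left R n k.1) (grid_point R n k.2)
  - (quadrant mu (grid_point R n k.1) (grid_left R n k.2)
  - quadrant mu (grid_left R n k.1) (grid_left R n k.2)).
  rewrite bmeasure_setI; last 2 first.
  - exact: measurable_unit_square.
  - exact: measurable_grid_box.
  by rewrite fine_rectangle//; exact: grid_left_le.
rewrite boxE; under eq_fun do rewrite boxE.
by apply: cvgB; apply: cvgB.
Qed.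

Theorem proposition18 (R : realType) :
  [/\ {within @Dset R, continuous (@Psi R)},
      @Psi R @` @Dset R = @permuton321 R
    & forall mu : meas2 R, permuton321 mu ->
        @Dset R `&` @Psi R @^-1` [set mu] =
        [set marginals (bmeasure_add (meas_lr mu) nu)
          | nu in [set nu : meas2 R | bmeasure_le nu (meas_diag mu)]]].
Proof.
split.
- exact: Psi_continuous.
- apply/seteqP; split => [_ [p Dp <-]|mu mu321]; first exact: Psi_permuton321.
  have [|Dp Psip] := @Psi_lr_diag _ _ (meas_diag mu) mu321; first by move=> A _.
  by exists (marginals (bmeasure_add (meas_lr mu) (meas_diag mu))).
- move=> mu mu321; apply/seteqP; split => [p [Dp Psip]|_ [nu nud <-]].
    by have [nu] := Psi_inverse Dp Psip; exists nu.
  exact: Psi_lr_diag.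
Qed.
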